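(* Let $T$ be a first order theory (every model of which has at least two elements). If $\varphi(x,y)$ is a stable formula of $T$, then $\mathbb P[\varphi(x,y)]$ is a stable formula of $T^R$. If $T$ is a stable theory then so is $T^R$.
   Context: $T^R$ is the randomization theory of $T$ in continuous logic, here taken in the one-sorted language whose sort consists of random elements, with a $[0,1]$-valued predicate $\mathbb P[\psi(\bar x)]$ for each first order formula $\psi(\bar x)$ of $T$ (intended as the probability that $\psi$ holds); equivalently, in the two-sorted presentation (sort $\mathbf K$ of random elements, sort $\mathbf B$ of events, functions $\llbracket\psi(\cdot)\rrbracket$, probability $\mu$), $\mathbb P[\psi]=\mu(\llbracket\psi\rrbracket)$, where $T^R$ says: events form an atomless finitely additive probability algebra, $\llbracket\cdot\rrbracket$ commutes with Boolean connectives and sends valid formulas and sentences of $T$ to $\top$, $d(x,y)=1-\mu\llbracket x=y\rrbracket$, and for each $\varphi(x,\bar y)$, $\llbracket\varphi(x,\bar y)\rrbracket$ can approximate $\llbracket\exists x\varphi(x,\bar y)\rrbracket$ arbitrarily well by choice of $x$, and every event is approximately $\llbracket x=y\rrbracket$. A first order formula $\varphi(x,y)$ is stable in $T$ if it does not have the order property. A continuous formula $\Phi(x,y)$ is stable in a continuous theory if there are no $r$, $\varepsilon>0$ and sequences $(a_i),(b_i)_{i<\omega}$ in a model with $\Phi(a_i,b_j)\le r$ and $\Phi(a_j,b_i)\ge r+\varepsilon$ for all $i<j$. A theory is stable if all its formulas are stable. *)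

(* Defs.v *)
From HB Require Import structures.
From mathcomp Require Import all_boot all_order all_algebra.
From mathcomp Require Import all_classical all_reals all_analysis.

Set Implicit Arguments.
Unset Strict Implicit.
Unset Printing Implicit Defensive.

Import Order.TTheory GRing.Theory Num.Theory.
Import numFieldTopology.Exports.

Local Open Scope classical_set_scope.
Local Open Scope ring_scope.

(* Finite tuples are functions on 'I_n.  [tcons x a] puts x at index 0, the
   index bound by every quantifier below. *)

Definition tcons (X : Type) (n : nat) (x : X) (a : 'I_n -> X) : 'I_n.+1 -> X :=
  fun i => if unlift ord0 i is Some j then a j else x.

Definition tcat (X : Type) (m n : nat) (a : 'I_m -> X) (b : 'I_n -> X) :
    'I_(m + n) -> X :=
  fun i => match fintype.split i with inl j => a j | inr j => b j end.

Record language := Language {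
  fun_sym : nat -> Type;
  rel_sym : nat -> Type
}.

Inductive term (L : language) (n : nat) : Type :=
| Var of 'I_n
| App k of fun_sym L k & ('I_k -> term L n).

(* [formula L n]: the formulas whose free variables are among n variables,
   indexed by 'I_n; the remaining connectives and the universal quantifier are
   abbreviations. *)
Inductive formula (L : language) : nat -> Type :=
| Equal n of term L n & term L n : formula L n
| Rel n k of rel_sym L k & ('I_k -> term L n) : formula L n
| Not n of formula L n : formula L n
| And n of formula L n & formula L n : formula L n
| Ex n of formula L n.+1 : formula L n.

Fixpoint trename (L : language) (m n : nat) (s : 'I_m -> 'I_n)
    (t : term L m) : term L n :=
  match t with
  | Var i => Var L (s i)
  | App _ f ts => App f (fun i => trename s (ts i))
  end.

Fixpoint frename (L : language) (m : nat) (p : formula L m) :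
    forall n : nat, ('I_m -> 'I_n) -> formula L n :=
  match p with
  | Equal _ t u => fun n s => Equal (trename s t) (trename s u)
  | Rel _ _ r ts => fun n s => Rel r (fun i => trename s (ts i))
  | Not _ p => fun n s => Not (frename p s)
  | And _ p q => fun n s => And (frename p s) (frename q s)
  | Ex _ p => fun n s => Ex (frename p (tcons ord0 (fun i => lift ord0 (s i))))
  end.

Record structure (L : language) := Structure {
  carrier :> Type;
  carrier_inh : inhabited carrier;
  fun_int : forall k, fun_sym L k -> ('I_k -> carrier) -> carrier;
  rel_int : forall k, rel_sym L k -> ('I_k -> carrier) -> Prop
}.

Fixpoint teval (L : language) (M : structure L) (n : nat) (a : 'I_n -> M)
    (t : term L n) : M :=
  match t with
  | Var i => a i
  | App _ f ts => fun_int f (fun i => teval a (ts i))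
  end.

Fixpoint sat (L : language) (M : structure L) (n : nat) (p : formula L n) :
    ('I_n -> M) -> Prop :=
  match p with
  | Equal _ t u => fun a => teval a t = teval a u
  | Rel _ _ r ts => fun a => rel_int r (fun i => teval a (ts i))
  | Not _ p => fun a => ~ sat p a
  | And _ p q => fun a => sat p a /\ sat q a
  | Ex _ p => fun a => exists x : M, sat p (tcons x a)
  end.

Definition valid (L : language) (n : nat) (p : formula L n) : Prop :=
  forall (M : structure L) (a : 'I_n -> M), sat p a.

Definition theory (L : language) := set (formula L 0).

Definition models (L : language) (T : theory L) (M : structure L) : Prop :=
  forall p : formula L 0, T p -> forall a : 'I_0 -> M, sat p a.

(* A formula p(x, y), with x an m-tuple and y an n-tuple of variables. *)
Definition order_property (L : language) (T : theory L) (m n : nat)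
    (p : formula L (m + n)) : Prop :=
  exists M : structure L, models T M /\
  exists (a : nat -> 'I_m -> M) (b : nat -> 'I_n -> M),
    forall i j : nat, sat p (tcat (a i) (b j)) <-> (i < j)%N.

Definition stable_formula (L : language) (T : theory L) (m n : nat)
    (p : formula L (m + n)) : Prop :=
  ~ order_property T p.

Definition stable_theory (L : language) (T : theory L) : Prop :=
  forall (m n : nat) (p : formula L (m + n)), stable_formula T p.

(* Metric signatures are relational: those of randomizations have no function
   symbols.  [pred_mod P] is the modulus of uniform continuity that the signature
   prescribes for the predicate symbol P. *)
Record csignature (R : realType) := CSignature {
  pred_sym : nat -> Type;
  pred_mod : forall k, pred_sym k -> R -> R;
  pred_mod_gt0 : forall k (P : pred_sym k) (e : R), 0 < e -> 0 < pred_mod P e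
}.

Record cstructure (R : realType) (S : csignature R) := CStructure {
  ccarrier :> metricType R;
  ccarrier_inh : inhabited ccarrier;
  ccarrier_complete : forall F : set_system ccarrier,
    ProperFilter F -> cauchy F -> exists x : ccarrier, F --> x;
  ccarrier_diam : forall x y : ccarrier, mdist x y <= 1;
  pred_int : forall k, pred_sym S k -> ('I_k -> ccarrier) -> R;
  pred_int_range : forall k (P : pred_sym S k) (a : 'I_k -> ccarrier),
    0 <= pred_int P a <= 1;
  pred_int_ucont : forall k (P : pred_sym S k) (e : R), 0 < e ->
    forall a b : 'I_k -> ccarrier,
    (forall i, mdist (a i) (b i) < pred_mod P e) ->
    `|pred_int P a - pred_int P b| <= e
}.

Definition cube (R : realType) (k : nat) : set 'rV[R]_k :=
  [set v | forall i, 0 <= v ord0 i <= 1].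

(* Connectives: all continuous maps [0,1]^k -> [0,1]; the values outside of
   the cube are never used. *)
Record connective (R : realType) (k : nat) := Connective {
  conn_fun :> 'rV[R]_k -> R;
  conn_cont : {within @cube R k, continuous conn_fun};
  conn_range : forall v : 'rV[R]_k, cube v -> 0 <= conn_fun v <= 1
}.

Inductive cformula (R : realType) (S : csignature R) : nat -> Type :=
| CDist n of 'I_n & 'I_n : cformula S n
| CPred n k of pred_sym S k & ('I_k -> 'I_n) : cformula S n
| CConn n k of connective R k & ('I_k -> cformula S n) : cformula S n
| CSup n of cformula S n.+1 : cformula S n
| CInf n of cformula S n.+1 : cformula S n.

Fixpoint ceval (R : realType) (S : csignature R) (M : cstructure S) (n : nat)
    (p : cformula S n) : ('I_n -> M) -> R :=
  match p with
  | CDist _ i j => fun a => mdist (a i) (a j)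
  | CPred _ _ P s => fun a => pred_int P (fun i => a (s i))
  | CConn _ _ u ps => fun a => u (\row_i ceval (ps i) a)
  | CSup _ p => fun a => sup (range (fun x : M => ceval p (tcons x a)))
  | CInf _ p => fun a => inf (range (fun x : M => ceval p (tcons x a)))
  end.

(* A continuous theory enters only through the class Mod of its models. *)
Definition cstable_formula (R : realType) (S : csignature R)
    (Mod : cstructure S -> Prop) (m n : nat) (p : cformula S (m + n)) : Prop :=
  ~ exists M : cstructure S, Mod M /\
    exists (r e : R) (a : nat -> 'I_m -> M) (b : nat -> 'I_n -> M),
      0 < e /\
      forall i j : nat, (i < j)%N ->
        ceval p (tcat (a i) (b j)) <= r /\
        r + e <= ceval p (tcat (a j) (b i)).

Definition cstable_theory (R : realType) (S : csignature R)
    (Mod : cstructure S -> Prop) : Prop :=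
  forall (m n : nat) (p : cformula S (m + n)), cstable_formula Mod p.

Section RandomizationSignature.
Variables (R : realType) (L : language).

(* |P[p](a) - P[p](b)| <= \sum_(i < n) d(a_i, b_i) holds in every
   randomization, hence the modulus e / (n + 1). *)
Definition rand_mod (n : nat) (p : formula L n) (e : R) : R := e / n.+1%:R.

Lemma rand_mod_gt0 (n : nat) (p : formula L n) (e : R) :
  0 < e -> 0 < rand_mod p e.
Proof. by move=> e0; rewrite divr_gt0. Qed.

(* The one-sorted language: one n-ary predicate symbol P[p] for each first
   order formula p in n variables. *)
Definition rand_sig : csignature R := CSignature rand_mod_gt0.

Definition Prob (n : nat) (p : formula L n) : cformula rand_sig n :=
  @CPred R rand_sig n n p id.

End RandomizationSignature.

Definition symdiff (disp : Order.disp_t) (B : ctbDistrLatticeType disp)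
    (x y : B) : B :=
  Order.join (Order.diff x y) (Order.diff y x).

(* The two-sorted presentation of the models of T^R.  [randomization T K] is
   the data of a sort B of events, brackets [ev p a] = [[p(a)]] and a
   probability mu, which together with the sort of random elements K satisfy
   the axioms of T^R and such that P[p] = mu [[p]] in K.  The metric on B is
   mu (symdiff b c). *)
Record randomization (R : realType) (L : language) (T : theory L)
    (K : cstructure (rand_sig R L)) := Randomization {
  ev_disp : Order.disp_t;
  ev_alg : ctbDistrLatticeType ev_disp;
  mu : ev_alg -> R;
  ev : forall n, formula L n -> ('I_n -> K) -> ev_alg;

  (* B is an atomless probability algebra, metrically complete as is every
     sort of a continuous structure.  Given completeness, atomlessness amounts
     to the condition  sup_b inf_c |mu (b /\ c) - mu b / 2| = 0. *)
  mu_ge0 : forall b, 0 <= mu b;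
  mu_eq0 : forall b, mu b = 0 -> b = Order.bottom;
  mu_top : mu Order.top = 1;
  mu_add : forall b c, Order.meet b c = Order.bottom ->
    mu (Order.join b c) = mu b + mu c;
  mu_complete : forall u : nat -> ev_alg,
    (forall e : R, 0 < e -> exists N : nat, forall i j : nat,
      (N <= i)%N -> (N <= j)%N -> mu (symdiff (u i) (u j)) < e) ->
    exists b, forall e : R, 0 < e -> exists N : nat, forall i : nat,
      (N <= i)%N -> mu (symdiff (u i) b) < e;
  mu_atomless : forall b, 0 < mu b ->
    exists c, (c <= b)%O /\ 0 < mu c < mu b;

  (* [ev_rename] expresses that [[p]] depends on p as a formula in named
     variables: substituting variables in p, or adding dummy ones, amounts to
     substituting the arguments. *)
  ev_rename : forall m n (p : formula L m) (s : 'I_m -> 'I_n) (a : 'I_n -> K),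
    ev (frename p s) a = ev p (fun i => a (s i));
  ev_not : forall n (p : formula L n) (a : 'I_n -> K),
    ev (Not p) a = Order.compl (ev p a);
  ev_and : forall n (p q : formula L n) (a : 'I_n -> K),
    ev (And p q) a = Order.meet (ev p a) (ev q a);
  ev_valid : forall n (p : formula L n), valid p ->
    forall a : 'I_n -> K, ev p a = Order.top;
  ev_theory : forall p : formula L 0, T p ->
    forall a : 'I_0 -> K, ev p a = Order.top;

  ev_dist : forall n (i j : 'I_n) (a : 'I_n -> K),
    mdist (a i) (a j) = 1 - mu (ev (Equal (Var L i) (Var L j)) a);
  ev_full : forall n (p : formula L n.+1) (a : 'I_n -> K) (e : R), 0 < e ->
    exists x : K, mu (symdiff (ev (Ex p) a) (ev p (tcons x a))) < e;
  ev_event : forall (b : ev_alg) (e : R), 0 < e ->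
    exists a : 'I_2 -> K,
      mu (symdiff b (ev (Equal (Var L ord0) (Var L ord_max)) a)) < e;

  ev_prob : forall n (p : formula L n) (a : 'I_n -> K),
    @pred_int R (rand_sig R L) K n p a = mu (ev p a)
}.

(* K is a model of T^R in the one-sorted language when it expands to a model of
   the two-sorted presentation. *)
Definition TR (R : realType) (L : language) (T : theory L)
    (K : cstructure (rand_sig R L)) : Prop :=
  inhabited (randomization T K).

(* Main.v *)
Require Import Defs.
From HB Require Import structures.
From mathcomp Require Import all_boot all_order all_algebra.
From mathcomp Require Import all_classical all_reals all_analysis.
From mathcomp Require Import lra ring zify.

(* Suppose that the reals mu [[phi(a_i, b_j)]] have a gap between i < j and
   j < i.  Lay out a complete binary tree of depth n in order on an interval of
   indices, let i be a random leaf, and add up with signs the truth values of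
   phi(a_i, b_t) at the nodes t above i, with sign + when i is to the right of t.
   The expected sum is at least n e / 2.  But a bipartite graph without long
   half-graphs has bounded Littlestone dimension, so that the exponential moment
   of the signed sum for a fixed graph is at most polynomial in n times
   (cosh d)^n, and its mean is o(n), uniformly in the graph.  Hence half-graphs of
   every length occur with positive probability.  An event of positive probability
   is realized in a first order structure, and an ultraproduct gives a model of T
   in which phi has the order property.

   For arbitrary continuous formulas, T^R eliminates quantifiers: values of a
   formula at a tuple are determined, up to e, by finitely many P[psi] up to some
   d.  The quantifier step is a back-and-forth argument, using that atomless
   probability algebras have events of all intermediate measures and that random
   elements can be glued along events.  Then, by Ramsey's theorem, an order
   sequence for the formula yields one for some psi or for its negation. *)

Set Implicit Arguments.
Unset Strict Implicit.
Unset Printing Implicit Defensive.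

Import Order.Theory GRing.Theory Num.Theory.
Import numFieldTopology.Exports.

(** * Half-graphs and Littlestone dimension *)

Section Ladders.
Local Open Scope classical_set_scope.
Variable E : nat -> nat -> bool.
Implicit Types (H Q : set nat).

(** Half-graphs of length [k], with the strict order of [order_property]. *)
Definition ladder (k : nat) H Q : Prop := exists a b : nat -> nat,
  (forall i, i < k -> H (a i) /\ Q (b i)) /\
  forall i j, i < k -> j < k -> E (a i) (b j) = (i < j).

(* Littlestone dimension of the rows in H, viewed as functions on the columns
   in Q, is at least d. *)
Fixpoint shatter (d : nat) H Q : Prop :=
  if d is d'.+1 then
    exists b, [/\ Q b, shatter d' (H `&` [set a | E a b]) Q
                     & shatter d' (H `&` [set a | ~~ E a b]) Q]
  else exists a, H a.

Lemma shatter_sub d H H' Q Q' :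
  H `<=` H' -> Q `<=` Q' -> shatter d H Q -> shatter d H' Q'.
Proof.
elim: d H H' => [|d IH] H H' HH QQ /=; first by case=> a /HH; exists a.
case=> b [/QQ Qb s1 s0]; exists b; split=> //.
- by apply: IH s1 => // x [/HH Hx ?]; split.
- by apply: IH s0 => // x [/HH Hx ?]; split.
Qed.

Lemma shatter_nonempty d H Q : shatter d H Q -> exists a, H a.
Proof.
elim: d H => //= d IH H [b [_ /IH [a [Ha _]] _]].
by exists a.
Qed.

(** A Ramsey argument on trees. Say the root lies in [P]: if both subtrees keep their depth inside
    [P], the root joins them; otherwise one of them already has the full depth outside [P]. *)
Lemma shatter_split d1 d2 H Q P : shatter (d1 + d2) H Q ->
  shatter d1 H (Q `&` P) \/ shatter d2 H (Q `&` ~` P).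
Proof.
elim: d1 d2 H => [|d1 IH1] d2 H; first by move/shatter_nonempty; left.
elim: d2 H => [|d2 IH2] H; first by move/shatter_nonempty; right.
rewrite addSn => -[b [Qb s1 s0]].
have subH B : H `&` B `<=` H by move=> ? [].
have [Pb|nPb] := pselect (P b).
- have [r1|r1] := IH1 _ _ s1; last by right; apply: shatter_sub r1.
  have [r0|r0] := IH1 _ _ s0; last by right; apply: shatter_sub r0.
  by left; exists b.
- have e : d1 + d2.+1 = d1.+1 + d2 by rewrite addnS.
  rewrite e in s1 s0.
  have [r1|r1] := IH2 _ s1; first by left; apply: shatter_sub r1.
  have [r0|r0] := IH2 _ s0; first by left; apply: shatter_sub r0.
  by right; exists b.
Qed.

(** Doubling pays for [shatter_split], the successor for the root column that is then used up. *)
Fixpoint ladder_depth (m : nat) : nat :=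
  if m is m'.+1 then (ladder_depth m').+1 + (ladder_depth m').+1 else 0.

(* Take any row a in H.  By shatter_split, half of the depth survives on columns
   where a is constant, say true; let b be the root of the remaining tree and
   continue with the rows that are false at b.  The pairs (a, b) so obtained are
   of two kinds. *)
Lemma shatter_two_ladders m p q H Q : m = p + q ->
    shatter (ladder_depth m) H Q ->
  (exists a b : nat -> nat, (forall i, i < p -> H (a i) /\ Q (b i)) /\
     forall i j, i < p -> j < p -> E (a i) (b j) = (i <= j)) \/
  (exists a b : nat -> nat, (forall i, i < q -> H (a i) /\ Q (b i)) /\
     forall i j, i < q -> j < q -> E (a i) (b j) = (j < i)).
Proof.
elim: m p q H Q => [|m IH] [|p] [|q] H Q // em.
- by move=> _; left; exists id, id.
- by move=> _; left; exists id, id.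
- by move=> _; right; exists id, id.
move=> sh; have [a Ha] := shatter_nonempty sh.
case: em; rewrite addnS => em.
have [] := shatter_split [set b | E a b] sh.
- move=> [b [[Qb /= Eab] _ s0]].
  have [|[a' [b' [HQ' E']]]|[a' [b' [HQ' E']]]] := IH p q.+1 _ _ _ s0.
  + by rewrite addnS.
  + left; exists (fun i => if i is i'.+1 then a' i' else a).
    exists (fun i => if i is i'.+1 then b' i' else b); split.
      case=> [|i]; first by [].
      by rewrite ltnS => /HQ' [[]] ? _ [].
    case=> [|i] [|j] //=; rewrite ?ltnS.
    * by move=> _ /HQ' [_ []].
    * by move=> /HQ' [[_ /= /negbTE]].
    * by move=> ? ?; rewrite E'.
  + by right; exists a', b'; split=> // i /HQ' [[? _] [? _]].
- move=> [b [[Qb /= /negP/negbTE Eab] s1 _]].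
  have [|[a' [b' [HQ' E']]]|[a' [b' [HQ' E']]]] := IH p.+1 q _ _ _ s1.
  + by rewrite addSn -em.
  + by left; exists a', b'; split=> // i /HQ' [[? _] [? _]].
  + right; exists (fun i => if i is i'.+1 then a' i' else a).
    exists (fun i => if i is i'.+1 then b' i' else b); split.
      case=> [|i]; first by [].
      by rewrite ltnS => /HQ' [[]] ? _ [].
    case=> [|i] [|j] //=; rewrite ?ltnS.
    * by move=> _ /HQ' [_ [_ /= /negP/negbTE]].
    * by move=> /HQ' [[_ /=]].
    * by move=> ? ?; rewrite E'.
Qed.

(** Shifting the rows by one turns [<=] into [<] and costs one index; reversing the indices turns
    [>] into [<]. Hence the lengths [k.+1] and [k]. *)
Lemma shatter_ladder k H Q :
  shatter (ladder_depth (k.+1 + k)) H Q -> ladder k H Q.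
Proof.
move=> /(shatter_two_ladders erefl) [] [a [b [HQ ab]]].
- exists (fun i => a i.+1), b; split=> [i ik|i j ik jk].
    by have [? _] := HQ i.+1 ik; have [_ ?] := HQ i (ltnW ik).
  by rewrite ab // ltnS ltnW.
- exists (fun i => a (k.-1 - i)), (fun i => b (k.-1 - i)).
  split=> [i ik|i j ik jk]; first by split; apply HQ; lia.
  by rewrite ab; lia.
Qed.

End Ladders.

(** * Signed averages along a binary tree and their exponential moments *)

Section TreeAverages.
Local Open Scope classical_set_scope.
Local Open Scope ring_scope.
Variable R : realType.
Implicit Types (H Q : set nat) (f : nat -> nat -> R) (g : nat -> R).

(* The complete binary tree of depth n is laid out in order on the interval
   [s, s + tree_size n): left subtree, root, right subtree. *)
Fixpoint tree_size (n : nat) : nat :=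
  if n is n'.+1 then ((tree_size n').*2.+1)%N else 1%N.

Fixpoint leaf_avg (n s : nat) g : R :=
  if n is n'.+1 then
    (leaf_avg n' s g + leaf_avg n' (s + tree_size n').+1 g) / 2
  else g s.

(* The average over the leaves i of \sum_b +-f i b, where b ranges over the
   nodes above i, with sign + if i is to the right of b and - otherwise. *)
Fixpoint tree_gap (n s : nat) f : R :=
  if n is n'.+1 then
    let t := (s + tree_size n')%N in
    (tree_gap n' s f + tree_gap n' t.+1 f) / 2 +
    (leaf_avg n' t.+1 (f^~ t) - leaf_avg n' s (f^~ t)) / 2
  else 0.

Lemma leaf_avgD n s g g' :
  leaf_avg n s (fun i => g i + g' i) = leaf_avg n s g + leaf_avg n s g'.
Proof. by elim: n s => [|n IH] s //=; rewrite !IH; field. Qed.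

Lemma leaf_avgZ n s c g :
  leaf_avg n s (fun i => c * g i) = c * leaf_avg n s g.
Proof. by elim: n s => [|n IH] s //=; rewrite !IH; field. Qed.

Lemma eq_leaf_avg n s g g' :
    (forall i, (s <= i < s + tree_size n)%N -> g i = g' i) ->
  leaf_avg n s g = leaf_avg n s g'.
Proof.
elim: n s => [|n IH] s gg' /=; first by apply: gg'; rewrite /=; lia.
by congr ((_ + _) / _); apply: IH => i hi; apply: gg' => /=; lia.
Qed.

Lemma leaf_avg_le n s g c :
    (forall i, (s <= i < s + tree_size n)%N -> g i <= c) ->
  leaf_avg n s g <= c.
Proof.
elim: n s => [|n IH] s gc /=; first by apply: gc; rewrite /=; lia.
have h1 : leaf_avg n s g <= c by apply: IH => i hi; apply: gc => /=; lia.
have h2 : leaf_avg n (s + tree_size n).+1 g <= c.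
  by apply: IH => i hi; apply: gc => /=; lia.
lra.
Qed.

Lemma leaf_avg_ge n s g c :
    (forall i, (s <= i < s + tree_size n)%N -> c <= g i) ->
  c <= leaf_avg n s g.
Proof.
elim: n s => [|n IH] s gc /=; first by apply: gc; rewrite /=; lia.
have h1 : c <= leaf_avg n s g by apply: IH => i hi; apply: gc => /=; lia.
have h2 : c <= leaf_avg n (s + tree_size n).+1 g.
  by apply: IH => i hi; apply: gc => /=; lia.
lra.
Qed.

Lemma tree_gapD n s f f' :
  tree_gap n s (fun i j => f i j + f' i j) = tree_gap n s f + tree_gap n s f'.
Proof.
by elim: n s => [|n IH] s /=; rewrite ?addr0// !IH !leaf_avgD; field.
Qed.

Lemma tree_gapZ n s c f :
  tree_gap n s (fun i j => c * f i j) = c * tree_gap n s f.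
Proof.
by elim: n s => [|n IH] s /=; rewrite ?mulr0// !IH !leaf_avgZ; field.
Qed.

Lemma eq_tree_gap n s f f' :
    (forall i j, (i < s + tree_size n)%N -> (j < s + tree_size n)%N ->
       f i j = f' i j) ->
  tree_gap n s f = tree_gap n s f'.
Proof.
elim: n s => [|n IH] s ff' //=.
congr ((_ + _) / _ + (_ - _) / _).
- by apply: IH => i j hi hj; apply: ff' => /=; lia.
- by apply: IH => i j hi hj; apply: ff' => /=; lia.
- by apply: eq_leaf_avg => i hi; apply: ff' => /=; lia.
- by apply: eq_leaf_avg => i hi; apply: ff' => /=; lia.
Qed.

Lemma tree_gap_sum (I : finType) n s (w : I -> R) (F : I -> nat -> nat -> R) :
  tree_gap n s (fun i j => \sum_p w p * F p i j) =
  \sum_p w p * tree_gap n s (F p).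
Proof.
under [RHS]eq_bigr do rewrite -tree_gapZ.
elim: (index_enum I) => [|p l IH].
  rewrite big_nil -[RHS](mul0r (tree_gap n s (fun _ _ => 0))) -tree_gapZ.
  by apply: eq_tree_gap => i j _ _; rewrite big_nil mul0r.
rewrite big_cons -IH -tree_gapD.
by apply: eq_tree_gap => i j _ _; rewrite big_cons.
Qed.

(** Each level contributes at least [e / 2]: in the column of a node, the leaves on its left have
    values at most [r], those on its right at least [r + e]. *)
Lemma tree_gap_ge n s f r e :
    (forall i j, (i < j)%N -> f i j <= r /\ r + e <= f j i) ->
  n%:R * (e / 2) <= tree_gap n s f.
Proof.
move=> fre; elim: n s => [|n IH] s /=; first by rewrite mul0r.
have h1 := IH s; have h2 := IH (s + tree_size n).+1.
set t := (s + tree_size n)%N.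
have h3 : leaf_avg n s (f^~ t) <= r.
  by apply: leaf_avg_le => i hi; apply fre; rewrite /t; lia.
have h4 : r + e <= leaf_avg n t.+1 (f^~ t).
  by apply: leaf_avg_ge => i hi; apply fre; lia.
rewrite -natr1; rewrite -/t in h2; lra.
Qed.

Section ExponentialMoment.
Variables (E : nat -> nat -> bool) (d : R).
Hypothesis d01 : 0 < d < 1.

(* The average over the leaves i of exp (g i + d * gap at i), where only the
   leaves in H contribute. *)
Fixpoint exp_moment (n s : nat) H g : R :=
  if n is n'.+1 then
    let t := (s + tree_size n')%N in
    (exp_moment n' s H (fun i => g i - d * (E i t)%:R) +
     exp_moment n' t.+1 H (fun i => g i + d * (E i t)%:R)) / 2
  else if `[< H s >] then expR (g s) else 0.

(** Average over the leaves the tangent bound [expR x >= expR z * (1 + x - z)]. *)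
Lemma exp_moment_ge n s H g z :
    (forall i, (s <= i < s + tree_size n)%N -> H i) ->
  expR z * (1 + leaf_avg n s g + d * tree_gap n s (fun i j => (E i j)%:R) - z)
    <= exp_moment n s H g.
Proof.
elim: n s g => [|n IH] s g Hs /=.
  rewrite asboolT; last by apply: Hs; rewrite /=; lia.
  have -> : expR (g s) = expR z * expR (g s - z) by rewrite -expRD addrC subrK.
  rewrite ler_pM2l ?expR_gt0//.
  by apply: le_trans _ (expR_ge1Dx _); lra.
set t := (s + tree_size n)%N.
have hl : forall i, (s <= i < s + tree_size n)%N -> H i.
  by move=> i hi; apply: Hs => /=; lia.
have hr : forall i, (t.+1 <= i < t.+1 + tree_size n)%N -> H i.
  by move=> i hi; apply: Hs => /=; lia.
have h1 := IH s (fun i => g i - d * (E i t)%:R) hl.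
have h2 := IH t.+1 (fun i => g i + d * (E i t)%:R) hr.
rewrite leaf_avgD leaf_avgZ in h2.
have e1 : leaf_avg n s (fun i => g i - d * (E i t)%:R) =
    leaf_avg n s g - d * leaf_avg n s (fun i => (E i t)%:R).
  by rewrite -mulNr -leaf_avgZ -leaf_avgD; under eq_leaf_avg do rewrite -mulNr.
rewrite e1 in h1.
rewrite ler_pdivlMr//; apply: le_trans (lerD h1 h2).
by rewrite le_eqVlt; apply/orP; left; apply/eqP; field.
Qed.

Lemma exp_momentU n s H (P : pred nat) g :
  exp_moment n s H g =
  exp_moment n s (H `&` [set i | P i]) g +
  exp_moment n s (H `&` [set i | ~~ P i]) g.
Proof.
elim: n s g => [|n IH] s g /=; last first.
  by rewrite (IH s) (IH (s + tree_size n).+1); field.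
case: asboolP => Hs; last first.
  by rewrite !asboolF ?addr0// => -[].
have [Ps|Ps] := boolP (P s).
- rewrite asboolT; last by split.
  by rewrite asboolF ?addr0// => -[_ /negP].
- rewrite asboolF; last by case=> _; apply/negP.
  by rewrite asboolT ?add0r.
Qed.

Lemma exp_moment0 n s H g : ~ (exists a, H a) -> exp_moment n s H g = 0.
Proof.
move=> H0; elim: n s g => [|n IH] s g /=; last by rewrite !IH addr0 mul0r.
by rewrite asboolF// => Hs; apply: H0; exists s.
Qed.

(** Average [expR x <= (1 - x)^-1] over [x = d] and [x = - d]. *)
Lemma cosh_le : (expR d + expR (- d)) / 2 <= (1 - d ^+ 2)^-1.
Proof.
have inv_le (x : R) : -1 < x < 1 -> expR x <= (1 - x)^-1.
  move=> x1; rewrite -[expR x]invrK -expRN lef_pV2 ?posrE ?expR_gt0//; last lra.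
  by apply: le_trans _ (expR_ge1Dx _); lra.
case/andP: d01 => d0 d1.
have h1 : expR d <= (1 - d)^-1 by apply: inv_le; apply/andP; split; lra.
have h2 : expR (- d) <= (1 - - d)^-1 by apply: inv_le; apply/andP; split; lra.
apply: (@le_trans _ _ (((1 - d)^-1 + (1 - - d)^-1) / 2)).
  by rewrite ler_pM2r ?invr_gt0//; exact: lerD.
rewrite le_eqVlt; apply/orP; left; apply/eqP; field.
by repeat (apply/andP; split); apply/eqP; nra.
Qed.

(* Splitting H by its values at the root column lowers the dimension of one of
   the two parts, whence the recursion B(n+1, r+1) = B(n, r+1) + B(n, r) of the
   Sauer-Shelah lemma, up to a factor cosh d at each level. *)
Lemma exp_moment_le n s H Q g c r : ~ shatter E r H Q ->
    (forall i, (s <= i < s + tree_size n)%N -> Q i) ->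
    (forall i, H i -> g i = c) ->
  exp_moment n s H g <= expR c * ((1 - d ^+ 2)^-1 ^+ n * n.+1%:R ^+ r).
Proof.
set C := (1 - d ^+ 2)^-1.
case/andP: (d01) => d0 d1; have d2 : 0 < 1 - d ^+ 2 by nra.
have C1 : 1 <= C by rewrite /C -[leLHS]invr1 lef_pV2 ?posrE//; nra.
have C0 : 0 <= C by lra.
elim: n s H g c r => [|n IH] s H g c r nsh Qs Hc /=.
  rewrite expr0 mul1r expr1n mulr1.
  by case: asboolP => [/Hc ->|_]; rewrite ?expR_ge0.
set t := (s + tree_size n)%N.
case: r nsh => [|r] nsh.
  by rewrite !exp_moment0 // addr0 mul0r !mulr_ge0 ?expR_ge0 ?exprn_ge0.
have Ql : forall i, (s <= i < s + tree_size n)%N -> Q i.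
  by move=> i hi; apply: Qs => /=; lia.
have Qr : forall i, (t.+1 <= i < t.+1 + tree_size n)%N -> Q i.
  by move=> i hi; apply: Qs => /=; lia.
have Qt : Q t by apply: Qs => /=; lia.
(* On either part the shifted exponent is again constant, as the induction hypothesis demands. *)
rewrite (exp_momentU _ _ _ (E^~ t)) (exp_momentU _ t.+1 _ (E^~ t)).
set H1 := H `&` [set i | E i t]; set H0 := H `&` [set i | ~~ E i t].
have nsh1 : ~ shatter E r.+1 H1 Q.
  by move=> h; apply: nsh; apply: shatter_sub h => // x [].
have nsh0 : ~ shatter E r.+1 H0 Q.
  by move=> h; apply: nsh; apply: shatter_sub h => // x [].
pose B k := C ^+ n * n.+1%:R ^+ k : R.
have B0 k : 0 <= B k by rewrite mulr_ge0 ?exprn_ge0.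
have l1 k (h : ~ shatter E k H1 Q) : exp_moment n s H1
    (fun i => g i - d * (E i t)%:R) <= expR c * (expR (- d) * B k).
  rewrite mulrA -expRD; apply: IH h Ql _ => i [Hi /= Ei].
  by rewrite Hc// Ei mulr1.
have l0 k (h : ~ shatter E k H0 Q) : exp_moment n s H0
    (fun i => g i - d * (E i t)%:R) <= expR c * B k.
  apply: IH h Ql _ => i [Hi /= /negbTE Ei].
  by rewrite Hc// Ei mulr0 subr0.
have r1 k (h : ~ shatter E k H1 Q) : exp_moment n t.+1 H1
    (fun i => g i + d * (E i t)%:R) <= expR c * (expR d * B k).
  rewrite mulrA -expRD; apply: IH h Qr _ => i [Hi /= Ei].
  by rewrite Hc// Ei mulr1.
have r0 k (h : ~ shatter E k H0 Q) : exp_moment n t.+1 H0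
    (fun i => g i + d * (E i t)%:R) <= expR c * B k.
  apply: IH h Qr _ => i [Hi /= /negbTE Ei].
  by rewrite Hc// Ei mulr0 addr0.
(* The left and right subtrees weigh [H1] by [expR (- d)] and [expR d], of mean at most [C]; the
   weight 1 of [H0] is at most [C] as well. *)
have key k1 k0 : ~ shatter E k1 H1 Q -> ~ shatter E k0 H0 Q ->
    B k1 + B k0 <= C ^+ n * n.+2%:R ^+ r.+1 ->
    (exp_moment n s H1 (fun i => g i - d * (E i t)%:R) +
     exp_moment n s H0 (fun i => g i - d * (E i t)%:R) +
    (exp_moment n t.+1 H1 (fun i => g i + d * (E i t)%:R) +
     exp_moment n t.+1 H0 (fun i => g i + d * (E i t)%:R))) / 2
   <= expR c * (C ^+ n.+1 * n.+2%:R ^+ r.+1).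
  move=> s1 s0 hB.
  apply: (@le_trans _ _ (expR c * ((expR d + expR (- d)) / 2 * B k1 + B k0))).
    have := lerD (lerD (l1 _ s1) (l0 _ s0)) (lerD (r1 _ s1) (r0 _ s0)).
    by lra.
  rewrite ler_pM2l ?expR_gt0//.
  apply: (@le_trans _ _ (C * (B k1 + B k0))).
    rewrite mulrDr; apply: lerD; first by rewrite ler_wpM2r// cosh_le.
    by rewrite ler_peMl.
  by rewrite exprS -mulrA ler_wpM2l.
have Bb : B r + B r.+1 <= C ^+ n * n.+2%:R ^+ r.+1.
  rewrite -mulrDr ler_wpM2l ?exprn_ge0// [X in X + _](_ : _ = 1 * n.+1%:R ^+ r) ?mul1r//.
  rewrite !exprS -[X in X + _]mul1r -mulrDl nat1r ler_wpM2l//.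
  by rewrite lerXn2r ?nnegrE// ler_nat.
have [sh1|nsh1'] := pselect (shatter E r H1 Q).
- have nsh0' : ~ shatter E r H0 Q by move=> sh0; apply: nsh; exists t.
  by apply: key nsh1 nsh0' _; rewrite addrC.
- exact: key nsh1' nsh0 _.
Qed.

End ExponentialMoment.

(** For [n = m * r.+1], Bernoulli's inequality gives [(1 + h) ^+ n >= (h * m.+1) ^+ r.+1], while
    [n.+1 ^+ r <= (r.+1 * m.+1) ^+ r]; the former is larger once [m.+1 > x]. *)
Lemma expn_lt_exp (h : R) r : 0 < h <= 1 ->
  exists2 n, (0 < n)%N & n.+1%:R ^+ r < (1 + h) ^+ n.
Proof.
move=> h01; pose x : R := r.+1%:R ^+ r / h ^+ r.+1.
have h0 : 0 < h by lra.
have hr0 : 0 < h ^+ r.+1 by rewrite exprn_gt0.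
pose m := (Num.truncn x).+1.
have xm : x < m.+1%:R by apply: lt_trans (truncnS_gt x) _; rewrite ltr_nat.
exists (m * r.+1)%N; first by rewrite muln_gt0.
apply: (@le_lt_trans _ _ (r.+1%:R ^+ r * m.+1%:R ^+ r)).
  by rewrite -exprMn lerXn2r ?nnegrE ?mulr_ge0// -natrM ler_nat; lia.
apply: (@lt_le_trans _ _ ((h * m.+1%:R) ^+ r.+1)).
  rewrite exprMn [X in _ < _ * X]exprS mulrA ltr_pM2r ?exprn_gt0//.
  by move: xm; rewrite /x ltr_pdivrMr// mulrC.
rewrite exprM lerXn2r ?nnegrE ?mulr_ge0 ?exprn_ge0//; try lra.
have bern k : 1 + k%:R * h <= (1 + h) ^+ k.
  elim: k => [|k IH]; first by rewrite expr0; lra.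
  rewrite exprS -natr1; have k0 : 0 <= k%:R :> R by [].
  have := ler_wpM2l (_ : 0 <= 1 + h) IH; move=> /(_ ltac:(lra)); nra.
by apply: le_trans _ (bern m); rewrite -natr1; nra.
Qed.

(** A Chernoff bound: a gap of [n * c] forces the exponential moment up to [expR (d * n * c)], but
    [exp_moment_le] keeps it below a polynomial times [(1 - d ^+ 2)^-1 ^+ n]. As [n] is chosen
    before [E], the bound can be averaged over random graphs. *)
Lemma ladder_free_tree_gap (k : nat) (c : R) : 0 < c -> exists2 n, (0 < n)%N & forall E,
  ~ ladder E k [set i | (i < tree_size n)%N] [set i | (i < tree_size n)%N] ->
  tree_gap n 0 (fun i j => (E i j)%:R) < n%:R * c.
Proof.
move=> c0; wlog c1 : c c0 / c <= 1.
  move=> th; have [c1|c1] := leP c 1; first exact: th.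
  have [n n0 hn] := th 1 ltr01 (lexx _); exists n => // E /hn h.
  by apply: lt_le_trans h _; rewrite ler_wpM2l// ltW.
(* This [d] makes the growth per level, [(1 + d * c) * (1 - d ^+ 2)], at least [1 + c ^+ 2 / 8]. *)
pose d := c / 2; have d01 : 0 < d < 1 by rewrite /d; lra.
have h01 : 0 < c ^+ 2 / 8 <= 1 by nra.
pose r := ladder_depth (k.+1 + k).
have [n n0 hn] := expn_lt_exp r h01.
exists n => // E nlad; rewrite ltNge; apply/negP => gap.
set N := [set i | (i < tree_size n)%N] in nlad.
have nsh : ~ shatter E r N N by move=> /shatter_ladder.
have NP i : (0 <= i < 0 + tree_size n)%N -> N i by [].
have up := exp_moment_le d01 nsh NP (fun i (_ : N i) => erefl (0 : R)).
rewrite expR0 mul1r in up.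
have lo := exp_moment_ge E d01 (fun=> 0) (d * (n%:R * c)) NP.
have z0 : leaf_avg n 0 (fun=> 0) = 0 :> R.
  by apply/le_anti/andP; split; [exact: leaf_avg_le|exact: leaf_avg_ge].
have := le_trans lo up; rewrite z0 addr0; apply/negP; rewrite -ltNge.
apply: (@lt_le_trans _ _ (expR (d * (n%:R * c)))); last first.
  rewrite ler_peMr ?expR_ge0//.
  have : d * (n%:R * c) <= d * tree_gap n 0 (fun i j => (E i j)%:R).
    by rewrite ler_pM2l; lra.
  lra.
have d2 : 0 < 1 - d ^+ 2 by nra.
rewrite mulrC exprVn ltr_pdivrMr ?exprn_gt0//.
apply: lt_le_trans hn _.
rewrite (_ : d * (n%:R * c) = n%:R * (d * c)); last by ring.
have h0 : 0 <= 1 + c ^+ 2 / 8 by lra.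
rewrite expRM_natl -exprMn lerXn2r ?nnegrE ?h0 ?mulr_ge0 ?expR_ge0 ?(ltW d2)//.
have h := expR_ge1Dx (d * c).
apply: (@le_trans _ _ ((1 + d * c) * (1 - d ^+ 2))); last first.
  by rewrite ler_pM2r.
have -> : d * c = c ^+ 2 / 2 by rewrite /d; ring.
have -> : d ^+ 2 = c ^+ 2 / 4 by rewrite /d; field.
have x0 : 0 <= c ^+ 2 by exact: sqr_ge0.
have x1 : c ^+ 2 <= 1 by nra.
nra.
Qed.

End TreeAverages.

(** * Atomless probability algebras *)

(* order.v registers distributivity only for unbounded lattices, where \join has
   no neutral element to start from. *)
HB.instance Definition _ (disp : Order.disp_t) (L : tbDistrLatticeType disp) :=
  Monoid.isAddLaw.Build L Order.meet Order.join meetUl meetUr.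

Section ProbabilityAlgebra.
Local Open Scope order_scope.
Local Open Scope ring_scope.
Variables (disp : Order.disp_t) (B : ctbDistrLatticeType disp).
Variables (R : realType) (mu : B -> R).
Implicit Types b c : B.
Hypothesis mu_ge0 : forall b, 0 <= mu b.
Hypothesis mu_add : forall b c, (b `&` c)%O = \bot%O ->
  mu (b `|` c)%O = mu b + mu c.

Lemma mu_bot : mu \bot%O = 0.
Proof. by have := mu_add (meet0x \bot%O); rewrite join0x; lra. Qed.

Lemma mu_split b c : mu b = mu (b `&` c)%O + mu (b `&` ~` c)%O.
Proof.
rewrite -mu_add; first by rewrite -meetUr joinxC meetx1.
by rewrite meetACA meetxC meetx0.
Qed.

Lemma mu_le b c : (b <= c)%O -> mu b <= mu c.
Proof.
by move=> /meet_r bc; rewrite (mu_split c b) bc lerDl.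
Qed.

Lemma mu_diff b c : (b <= c)%O -> mu (c `&` ~` b)%O = mu c - mu b.
Proof. by move=> bc; rewrite [in RHS](mu_split c b) (meet_r bc); lra. Qed.

Lemma mu_joinD b c : mu (b `|` c)%O <= mu b + mu c.
Proof.
rewrite (mu_split _ b) (meet_r (leUl b c)) meetUl meetxC join0x.
by rewrite lerD2l; apply: mu_le; exact: leIl.
Qed.

Lemma mu_diff_symdiff b c : mu (b `&` ~` c)%O <= mu (symdiff b c).
Proof. by apply: mu_le; rewrite /symdiff !diffE; exact: leUl. Qed.

Lemma symdiffC b c : symdiff b c = symdiff c b.
Proof. by rewrite /symdiff joinC. Qed.

Lemma mu_bigjoin (I : eqType) (s : seq I) (F : I -> B) : uniq s ->
    (forall i j, i != j -> (F i `&` F j)%O = \bot%O) ->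
  mu (\join_(i <- s) F i)%O = \sum_(i <- s) mu (F i).
Proof.
move=> + dis; elim: s => [|i s IH] /= => [_|/andP[is_ us]].
  by rewrite !big_nil mu_bot.
rewrite !big_cons mu_add ?IH// big_distrr/= big_seq big1// => j js.
by apply: dis; apply: contraNneq is_ => ->.
Qed.

Section Atoms.
Variables (J : finType) (e : J -> B).

Definition atom (p : {ffun J -> bool}) : B :=
  (\meet_(j : J) (if p j then e j else ~` e j))%O.

Lemma atom_le p j : (atom p <= if p j then e j else ~` e j)%O.
Proof. exact: meets_inf. Qed.

Lemma atom_disjoint p q : p != q -> (atom p `&` atom q)%O = \bot%O.
Proof.
move=> pq; have /existsP[j pqj] : [exists j, p j != q j].
  apply: contraNT pq => /existsPn h; apply/eqP/ffunP => j.
  by have := h j; rewrite negbK => /eqP.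
apply/eqP; rewrite -lex0; apply: le_trans (leI2 (atom_le p j) (atom_le q j)) _.
by case: (p j) (q j) pqj => -[] //= _; rewrite ?meetxC ?meetCx.
Qed.

Lemma join_atom : (\join_p atom p)%O = \top%O :> B.
Proof.
rewrite -(bigA_distr_bigA (fun j (x : bool) => if x then e j else ~` e j)%O).
by rewrite big1// => j _; rewrite big_bool/= joinxC.
Qed.

Lemma mu_atoms b : \sum_p mu (b `&` atom p)%O = mu b.
Proof.
rewrite -[in RHS](meetx1 b) -join_atom big_distrr/= mu_bigjoin ?index_enum_uniq//.
by move=> p q pq; rewrite meetACA (atom_disjoint pq) meetx0.
Qed.

Lemma mu_meet_atoms b j :
  \sum_(p : {ffun J -> bool} | p j) mu (b `&` atom p)%O = mu (b `&` e j)%O.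
Proof.
rewrite -[RHS]mu_atoms [RHS](bigID (fun p : {ffun _} => p j))/=.
rewrite [X in _ + X]big1 ?addr0 => [|p /negbTE pj].
  apply: eq_bigr => p pj; congr mu; rewrite -meetA; congr (_ `&` _)%O.
  by apply/esym/meet_r; have := atom_le p j; rewrite pj.
apply/eqP; rewrite eq_le mu_ge0 andbT -mu_bot; apply: mu_le.
have := atom_le p j; rewrite pj => h.
by rewrite -meetA; apply: le_trans (leIr _ _) _; rewrite -(meetxC (e j)) leI2.
Qed.

End Atoms.

(** * Events of prescribed measure *)

Section Sierpinski.
Hypothesis mu_eq0 : forall b, mu b = 0 -> b = \bot%O.
Hypothesis mu_complete : forall u : nat -> B,
  (forall e : R, 0 < e -> exists N : nat, forall i j : nat,
    (N <= i)%N -> (N <= j)%N -> mu (symdiff (u i) (u j)) < e) ->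
  exists b, forall e : R, 0 < e -> exists N : nat, forall i : nat,
    (N <= i)%N -> mu (symdiff (u i) b) < e.
Hypothesis mu_atomless : forall b, 0 < mu b ->
  exists c, (c <= b)%O /\ 0 < mu c < mu b.

(** Of two parts of an event, one has at most half the measure. The bound [mu b / k.+1] is cruder
    than a power of 2 but suffices. *)
Lemma mu_small b e : 0 < mu b -> 0 < e ->
  exists c, [/\ (c <= b)%O, 0 < mu c & mu c <= e].
Proof.
move=> b0 e0.
have half k : exists c, [/\ (c <= b)%O, 0 < mu c & mu c * k.+1%:R <= mu b].
  elim: k => [|k [c [cb c0 ck]]]; first by exists b; rewrite lexx mulr1.
  have [c' [cc' /andP[c'0 c'c]]] := mu_atomless c0.
  have k0 : (0 : R) <= k%:R by [].
  have d := mu_diff cc'; rewrite -[k.+2%:R]natr1 -natr1 in ck *.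
  have [h|h] := leP (mu c') (mu c / 2).
    exists c'; split=> //; first exact: le_trans cb.
    by nra.
  exists (c `&` ~` c')%O; rewrite d; split; [|lra|nra].
  exact: le_trans (leIl _ _) cb.
have [c [cb c0 ck]] := half (Num.truncn (mu b / e)).
exists c; split=> //.
have /ltW := truncnS_gt (mu b / e); rewrite ler_pdivrMr// => h.
have := le_trans ck h; rewrite mulrC ler_pM2l//.
Qed.

(** The supremum of the admissible measures is only approached, whence the factor 2; if it is 0,
    [\bot] serves. *)
Lemma mu_greedy b t c : mu c <= t -> exists d,
  [/\ (d <= b `&` ~` c)%O, mu c + mu d <= t &
      forall d', (d' <= b `&` ~` c)%O -> mu c + mu d' <= t ->
        mu d' <= 2 * mu d].
Proof.
move=> ct.
pose S := [set mu d | d in [set d | (d <= b `&` ~` c)%O /\ mu c + mu d <= t]]%classic.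
have S0 : S 0 by exists \bot%O; rewrite /= ?mu_bot// le0x addr0.
have ubS : has_sup S.
  by split; [exists 0 | exists (t - mu c) => _ [d [_ /= h] <-]; lra].
have [s0|s0] := leP (sup S) 0.
  exists \bot%O; rewrite le0x mu_bot addr0; split=> // d' h1 h2.
  rewrite mulr0; apply: le_trans s0; apply: sup_upper_bound => //.
  by exists d'.
have [|_ [d [h1 h2] <-] h] := @sup_adherent _ _ (sup S / 2) _ ubS; first by lra.
exists d; split=> // d' h1' h2'.
have : mu d' <= sup S by apply: sup_upper_bound => //; exists d'.
by lra.
Qed.

(** Bounded monotone measures make the sequence Cauchy; the limit is an upper bound because null
    differences are empty. *)
Lemma mu_nondecreasing_limit (u : nat -> B) t :
    (forall n, (u n <= u n.+1)%O) -> (forall n, mu (u n) <= t) ->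
  exists c, (forall n, (u n <= c)%O) /\
            forall e, 0 < e -> exists n, mu (c `&` ~` u n)%O < e.
Proof.
move=> uS ut.
have um i j : (i <= j)%N -> (u i <= u j)%O.
  move=> /subnK <-; elim: (j - i)%N => // k IH.
  by rewrite addSn; apply: le_trans IH (uS _).
have [|c hc] := mu_complete (u := u).
  move=> e e0; pose S := range (mu \o u).
  have ubS : has_sup S.
    by split; [exists (mu (u 0%N)), 0%N | exists t => _ [n _ <-]; exact: ut].
  have [_ [N _ <-] h] := sup_adherent e0 ubS.
  exists N => i j Ni Nj.
  apply: (@le_lt_trans _ _ (mu (u (maxn i j) `&` ~` u N)%O)).
    apply: mu_le; rewrite /symdiff !diffE leUx; apply/andP; split;
      by apply: leI2; rewrite ?leC; apply: um; rewrite ?leq_maxl ?leq_maxr.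
  rewrite mu_diff; last by apply: um; rewrite leq_max Ni.
  have : mu (u (maxn i j)) <= sup S by apply: sup_upper_bound => //; exists (maxn i j).
  by move: h => /=; lra.
exists c; split.
  move=> n; rewrite -diff_eq0 diffE; apply/eqP/mu_eq0.
  apply/le_anti; rewrite mu_ge0 andbT; apply/ler_addgt0Pl => e e0; rewrite addr0.
  have [N hN] := hc e e0.
  apply: le_trans (ltW (hN (maxn N n) (leq_maxl _ _))).
  apply: le_trans (mu_diff_symdiff _ _); apply: mu_le.
  by apply: leI2 => //; apply: um; exact: leq_maxr.
move=> e e0; have [N hN] := hc e e0; exists N.
by apply: le_lt_trans (hN N _); rewrite // symdiffC; exact: mu_diff_symdiff.
Qed.

(* Exhaustion: greedily add disjoint pieces without exceeding t.  If the limit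
   had measure less than t, a small piece of the complement could always have
   been added, so the measures would grow without bound. *)
Lemma sierpinski b t : 0 <= t <= mu b -> exists2 c, (c <= b)%O & mu c = t.
Proof.
move=> /andP[t0 tb].
have /choice[f hf] : forall c, exists d, mu c <= t ->
  [/\ (d <= b `&` ~` c)%O, mu c + mu d <= t &
      forall d', (d' <= b `&` ~` c)%O -> mu c + mu d' <= t ->
        mu d' <= 2 * mu d].
  move=> c; have [ct|ct] := leP (mu c) t; last by exists c.
  by have [d hd] := mu_greedy b ct; exists d.
pose u n := iter n (fun c => c `|` f c)%O \bot%O.
have uS n : u n.+1 = (u n `|` f (u n))%O by [].
have mus n : (f (u n) <= b `&` ~` u n)%O -> mu (u n.+1) = mu (u n) + mu (f (u n)).
  move=> h; rewrite uS mu_add//; apply/eqP; rewrite -lex0.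
  apply: le_trans (leI2 (lexx _) h) _.
  by rewrite meetCA meetxC meetx0.
have ut n : (u n <= b)%O /\ mu (u n) <= t.
  elim: n => [|n [ub ut]]; first by rewrite /u/= le0x mu_bot.
  have [h1 h2 _] := hf _ ut.
  rewrite mus//; split=> //; rewrite uS leUx ub/=.
  exact: le_trans h1 (leIl _ _).
have [||c [uc hc]] := @mu_nondecreasing_limit u t.
- by move=> n; rewrite uS; exact: leUl.
- by move=> n; have [] := ut n.
have cb : (c <= b)%O.
  rewrite -diff_eq0 diffE; apply/eqP/mu_eq0.
  apply/le_anti; rewrite mu_ge0 andbT; apply/ler_addgt0Pl => e e0; rewrite addr0.
  have [n /ltW hn] := hc e e0; apply: le_trans hn; apply: mu_le.
  by apply: leI2 => //; rewrite leC; have [] := ut n.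
have ct : mu c <= t.
  apply/ler_addgt0Pl => e e0; have [n hn] := hc e e0.
  by move: hn; rewrite mu_diff//; have [_] := ut n; lra.
exists c => //; apply/le_anti; rewrite ct/= leNgt; apply/negP => ct'.
have [||d [dbc d0 dt]] := @mu_small (b `&` ~` c)%O (t - mu c).
- by rewrite mu_diff//; lra.
- by lra.
(* The piece [d] stays admissible at every stage, so each greedy piece has at least half its
   measure. *)
have grow n : n%:R * (mu d / 2) <= mu (u n).
  elim: n => [|n IH]; first by rewrite mul0r.
  have [_ un] := ut n; have [h1 h2 h3] := hf _ un.
  rewrite mus// -natr1; suff : mu d <= 2 * mu (f (u n)) by lra.
  apply: h3.
    by apply: le_trans dbc _; apply: leI2 => //; rewrite leC.
  by have := mu_le (uc n); lra.
have d2 : 0 < mu d / 2 by lra.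
have := truncnS_gt (t / (mu d / 2)); rewrite ltr_pdivrMr// => h.
have [_] := ut (Num.truncn (t / (mu d / 2))).+1.
by have := grow (Num.truncn (t / (mu d / 2))).+1; lra.
Qed.

(** Cut the pieces one after another, each by [sierpinski] from what the earlier ones leave of
    [b]. *)
Lemma mu_pack (J : eqType) (s : seq J) (t : J -> R) b : uniq s ->
    (forall j, 0 <= t j) -> \sum_(j <- s) t j <= mu b ->
  exists c : J -> B,
    (forall j, j \in s -> (c j <= b)%O /\ mu (c j) = t j) /\
    (forall i j, i \in s -> j \in s -> i != j -> (c i `&` c j)%O = \bot%O).
Proof.
move=> + t0; elim: s b => [|x s IH] b /=; first by move=> _ _; exists (fun=> b).
rewrite big_cons => /andP[xs us] h.
have hs : 0 <= \sum_(j <- s) t j by apply: sumr_ge0.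
have [|c0 c0b c0t] := @sierpinski b (t x); first by rewrite t0/=; lra.
have [|c [hc dc]] := IH (b `&` ~` c0)%O us.
  by rewrite mu_diff// c0t; lra.
have disj j : j \in s -> (c j `&` c0)%O = \bot%O.
  move=> /hc[h1 _]; apply/eqP; rewrite -lex0.
  by apply: le_trans (leI2 h1 (lexx _)) _; rewrite -meetA meetCx meetx0.
exists (fun j => if j == x then c0 else c j); split.
  move=> j; rewrite inE; case: eqP => [-> _|_ /= /hc[h1 h2]]; first by [].
  by split=> //; apply: le_trans h1 (leIl _ _).
move=> i j; rewrite !inE; case: eqP => [->|_]; case: eqP => [->|_] //=.
- by rewrite eqxx.
- by move=> _ js _; rewrite meetC disj.
- by move=> is_ _ _; rewrite disj.
- exact: dc.
Qed.

End Sierpinski.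
End ProbabilityAlgebra.

(** * Ultraproducts and compactness *)

(** Classical decidable equality, for membership in lists of formulas. *)
HB.instance Definition _ (L : language) (n : nat) := gen_eqMixin (formula L n).

Lemma choice_dep (X : Type) (Y : X -> Type) (P : forall x, Y x -> Prop) :
  (forall x, exists y, P x y) -> exists f : forall x, Y x, forall x, P x (f x).
Proof. by move=> h; exists (fun x => sval (cid (h x))) => x; case: cid. Qed.

Lemma tcons_comp (X Y : Type) (n : nat) (f : X -> Y) (x : X) (a : 'I_n -> X) :
  f \o tcons x a = tcons (f x) (f \o a).
Proof. by apply/funext => i; rewrite /tcons /=; case: unlift. Qed.

Lemma tcat_comp (X Y : Type) (m n : nat) (f : X -> Y) (a : 'I_m -> X)
    (b : 'I_n -> X) :
  f \o tcat a b = tcat (f \o a) (f \o b).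
Proof. by apply/funext => i; rewrite /tcat /=; case: fintype.split. Qed.

Section Substitution.
Variables (L : language) (M : structure L).

Lemma teval_trename m n (s : 'I_m -> 'I_n) (a : 'I_n -> M) (t : term L m) :
  teval a (trename s t) = teval (fun i => a (s i)) t.
Proof.
by elim: t => //= k f ts IH; congr fun_int; apply/funext => i; exact: IH.
Qed.

Lemma sat_frename m (p : formula L m) n (s : 'I_m -> 'I_n) (a : 'I_n -> M) :
  sat (frename p s) a <-> sat p (fun i => a (s i)).
Proof.
elim: p n s a => /= {m} [m t u|m k r ts|m p IH|m p IHp q IHq|m p IH] n s a.
- by rewrite !teval_trename.
- by rewrite (_ : (fun i => _) = (fun i => teval (fun i => a (s i)) (ts i)))//;
    apply/funext => i; rewrite teval_trename.
- by rewrite IH.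
- by rewrite IHp IHq.
- have e x : (fun i => tcons x a (tcons ord0 (fun i => lift ord0 (s i)) i)) =
             tcons x (fun i => a (s i)).
    apply/funext => i; rewrite {2 3}/tcons; case: unlift => [j|].
      by rewrite /tcons liftK.
    by rewrite /tcons unlift_none.
  by split=> -[x hx]; exists x; [move/IH: hx; rewrite e | apply/IH; rewrite e].
Qed.

End Substitution.

Section Ultraproduct.
Local Open Scope classical_set_scope.
Variables (L : language) (I : Type) (M : I -> structure L).
Variables (U : set_system I) (UU : UltraFilter U).

Let Pi := forall i, M i.

Definition ultra_eq (x y : Pi) : Prop := U [set i | x i = y i].

Lemma ultra_eq_sym x y : ultra_eq x y -> ultra_eq y x.
Proof. by apply: filterS => i /=. Qed.

Lemma ultra_eq_trans x y z : ultra_eq x y -> ultra_eq y z -> ultra_eq x z.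
Proof. by apply: filterS2 => i /= -> . Qed.

Lemma ultra_inh : exists x : Pi, True.
Proof.
have /choice_dep[x _] : forall i, exists y : M i, True.
  by move=> i; case: (carrier_inh (M i)) => y; exists y.
by exists x.
Qed.

Definition ultra_default : Pi := sval (cid ultra_inh).

(** The result depends only on the extension of [P], so that [canon] agrees on equivalent
    families. *)
Definition ultra_pick (P : Pi -> Prop) : Pi :=
  if pselect (exists y, P y) is left h then sval (cid h) else ultra_default.

Definition canon (x : Pi) : Pi := ultra_pick (ultra_eq x).

Lemma canon_eq x : ultra_eq x (canon x).
Proof.
rewrite /canon /ultra_pick; case: pselect => [h|[]]; first by case: cid.
by exists x; apply: filterE.
Qed.

Lemma eq_canon x y : ultra_eq x y -> canon x = canon y.
Proof.
move=> xy; rewrite /canon; congr ultra_pick; apply/funext => z; apply/propext.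
split; first exact/ultra_eq_trans/ultra_eq_sym.
exact: ultra_eq_trans.
Qed.

Lemma canon_idem x : canon (canon x) = canon x.
Proof. exact/eq_canon/ultra_eq_sym/canon_eq. Qed.

(* Instead of a quotient, the fixed points of a choice of representatives. *)
Definition ultra_carrier := {x : Pi | canon x = x}.

Definition ultra_class (x : Pi) : ultra_carrier := exist _ (canon x) (canon_idem x).

Definition ultraproduct : structure L :=
  @Structure L ultra_carrier (inhabits (ultra_class ultra_default))
    (fun k f a => ultra_class (fun i => fun_int f (fun v => sval (a v) i)))
    (fun k r a => U [set i | rel_int r (fun v => sval (a v) i)]).

Lemma ultra_classE (x : Pi) : ultra_eq (sval (ultra_class x)) x.
Proof. exact/ultra_eq_sym/canon_eq. Qed.

Lemma ultra_eqP (x y : ultraproduct) : x = y <-> ultra_eq (sval x) (sval y).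
Proof.
split=> [->|xy]; first by apply: filterE.
case: x y xy => [x hx] [y hy] /= /eq_canon; rewrite hx hy => xy.
by subst y; congr exist; exact: Prop_irrelevance.
Qed.

Lemma teval_ultraproduct n (a : 'I_n -> ultraproduct) (t : term L n) :
  U [set i | sval (teval a t) i = teval (fun v => sval (a v) i) t].
Proof.
elim: t => [v|k f ts IH] /=; first by apply: filterE.
have h : U [set i | forall v, sval (teval a (ts v)) i =
    teval (fun v => sval (a v) i) (ts v)] by apply: filter_forall => v; exact: IH.
have hf := ultra_classE (fun i => fun_int f (fun v => sval (teval a (ts v)) i)).
apply: filterS2 h hf => i /= h ->.
by congr fun_int; apply/funext => v; rewrite h.
Qed.

Theorem Los n (p : formula L n) (a : 'I_n -> ultraproduct) :
  sat p a <-> U [set i | sat p (fun v => sval (a v) i)].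
Proof.
elim: p a => {n} [n t u|n k r ts|n p IH|n p IHp q IHq|n p IH] a /=.
- rewrite ultra_eqP; have ht := teval_ultraproduct a t.
  have hu := teval_ultraproduct a u.
  by split; apply: filterS3 ht hu => i /= <- <-.
- have h : U [set i | forall j, sval (teval a (ts j)) i =
      teval (fun v => sval (a v) i) (ts j)].
    by apply: filter_forall => j; exact: teval_ultraproduct.
  by split; apply: filterS2 h => i /= h; rewrite (_ : (fun _ => _) =
    (fun j => teval (fun v => sval (a v) i) (ts j)))//; apply/funext => j; rewrite h.
- rewrite IH; split=> [nU|U1 U2].
    by have [//|] := in_ultra_setVsetC [set i | sat p (fun v => sval (a v) i)] UU.
  by have [i []] := filter_ex (filterI U1 U2).
- rewrite IHp IHq; split=> [[]|h]; first by apply: filterS2.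
  by split; apply: filterS h => i [].
- have e (x : ultraproduct) i : (fun v => sval (tcons x a v) i) =
      tcons (sval x i) (fun v => sval (a v) i).
    exact: (tcons_comp (fun y : ultraproduct => sval y i)).
  split=> [[x /IH]|h].
    by apply: filterS => i /=; rewrite e => ?; exists (sval x i).
  (* Witnesses are chosen coordinatewise, with a default where there is none; by [h] this happens
     outside a set of [U]. *)
  have /choice_dep[x hx] : forall i, exists y : M i,
      (exists x, sat p (tcons x (fun v => sval (a v) i))) ->
      sat p (tcons y (fun v => sval (a v) i)).
    move=> i; have [[y hy]|nex] := pselect (exists x, sat p (tcons x (fun v => sval (a v) i))).
      by exists y.
    by exists (ultra_default i) => /nex.
  exists (ultra_class x); apply/IH.
  apply: filterS2 h (ultra_classE x) => i /= /hx hi ei.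
  by rewrite e /= ei.
Qed.

End Ultraproduct.

(** * Compactness by ultraproducts *)

Section Compactness.
Local Open Scope classical_set_scope.
Variables (L : language) (T : theory L).

(** The indices are the finite requirements: a length and a list of axioms. An ultrafilter
    containing all final segments makes the ultraproduct meet every requirement, by [Los]. *)
Lemma order_property_compact m n (phi : formula L (m + n)) :
    (forall (G : seq (formula L 0)) (k : nat), (forall p, p \in G -> T p) ->
       exists (M : structure L) (a : nat -> 'I_m -> M) (b : nat -> 'I_n -> M),
       (forall p, p \in G -> forall c : 'I_0 -> M, sat p c) /\
       forall i j, (i < k)%N -> (j < k)%N ->
         (sat phi (tcat (a i) (b j)) <-> (i < j)%N)) ->
  order_property T phi.
Proof.
move=> fin; pose I := (nat * {G : seq (formula L 0) | forall p, p \in G -> T p})%type.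
have /choice_dep[M hM] : forall i : I, exists M : structure L,
    exists (a : nat -> 'I_m -> M) (b : nat -> 'I_n -> M),
    (forall p, p \in sval i.2 -> forall c : 'I_0 -> M, sat p c) /\
    forall s t, (s < i.1)%N -> (t < i.1)%N ->
      (sat phi (tcat (a s) (b t)) <-> (s < t)%N).
  by move=> i; apply: fin; exact: (svalP i.2).
have /choice_dep[a ha] := hM.
have /choice_dep[b hb] := ha.
have T0 (p : formula L 0) : p \in [::] -> T p by [].
pose F := filter_from setT (fun i : I =>
  [set j : I | (i.1 <= j.1)%N /\ {subset sval i.2 <= sval j.2}]).
have FP : ProperFilter F.
  apply: filter_from_proper => [|i _]; last by exists i; split.
  apply: filter_from_filter; first by exists (0%N, exist _ [::] T0).
  move=> [k [G hG]] [l [H hH]] _ _.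
  have hGH p : p \in G ++ H -> T p by rewrite mem_cat => /orP[/hG|/hH].
  exists (maxn k l, exist _ (G ++ H) hGH) => // -[i [J hJ]] [/= h1 h2]; split; split=> /=.
  - by apply: leq_trans h1; exact: leq_maxl.
  - by move=> p pG; apply: h2; rewrite mem_cat pG.
  - by apply: leq_trans h1; exact: leq_maxr.
  - by move=> p pG; apply: h2; rewrite mem_cat pG orbT.
have [U [UU FU]] := ultraFilterLemma FP.
pose A s u := ultra_class UU (fun i => a i s u).
pose B s u := ultra_class UU (fun i => b i s u).
exists (ultraproduct M UU); split.
  move=> p Tp c; apply/Los.
  have hp q : q \in [:: p] -> T q by rewrite inE => /eqP ->.
  apply: FU; exists (0%N, exist _ [:: p] hp) => // i [_ /= h] /=.
  by have [+ _] := hb i; apply; apply: h; rewrite inE.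
exists A, B => s t; rewrite Los.
have hU : U [set i | (sat phi (fun v => sval (tcat (A s) (B t) v) i)) <-> (s < t)%N].
  have U1 : U [set i | forall u, sval (A s u) i = a i s u].
    by apply: filter_forall => u; exact: ultra_classE.
  have U2 : U [set i | forall u, sval (B t u) i = b i t u].
    by apply: filter_forall => u; exact: ultra_classE.
  have U3 : U [set i : I | (s < i.1)%N /\ (t < i.1)%N].
    apply: FU; exists ((maxn s t).+1, exist _ [::] T0) => // i [/= h _].
    by split; apply: leq_trans h; rewrite ltnS ?leq_maxl ?leq_maxr.
  apply: filterS3 U1 U2 U3 => i /= h1 h2 [h3 h4].
  rewrite (_ : (fun v => _) = tcat (a i s) (b i t)); last first.
    rewrite -[LHS]/((fun x : ultraproduct M UU => sval x i) \o tcat (A s) (B t)) tcat_comp.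
    by congr tcat; apply/funext.
  by have [_] := hb i; apply.
split=> [h|st].
  by have [i [/= h1 h2]] := filter_ex (filterI h hU); apply/h2.
by apply: filterS hU => i /= [_]; apply.
Qed.

End Compactness.

(** * Stability of P[phi] *)

Section RandomizationBasics.
Local Open Scope classical_set_scope.
Local Open Scope ring_scope.
Variables (R : realType) (L : language) (T : theory L).
Variables (K : cstructure (rand_sig R L)) (rz : randomization T K).

Lemma ev_le n (p q : formula L n) (a : 'I_n -> K) :
    (forall (M : structure L) (c : 'I_n -> M), sat p c -> sat q c) ->
  (ev rz p a <= ev rz q a)%O.
Proof.
move=> pq; have h : valid (Not (And p (Not q))).
  by move=> M c /= [/pq].
have := ev_valid rz h a; rewrite ev_not ev_and ev_not => e.
by rewrite -diff_eq0 diffE -[X in X == _]complK e compl1.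
Qed.

(** Otherwise the negated conjunction of [G] would be valid, so that the bracket of the conjunction,
    which lies above [b], would be [\bot]. *)
Lemma satisfiable n (G : seq (formula L n)) (a : 'I_n -> K) (b : ev_alg rz) :
    b != \bot%O -> (forall p, p \in G -> (b <= ev rz p a)%O) ->
  exists (M : structure L) (c : 'I_n -> M), forall p, p \in G -> sat p c.
Proof.
move=> b0 bG; apply: contrapT => nsat.
(* A true formula without free variables, as [n] may be 0. *)
pose top : formula L n := Ex (Equal (Var L ord0) (Var L ord0)).
have vtop : valid top.
  by move=> M c; case: (carrier_inh M) => x; exists x.
pose conj := foldr (@And L n) top.
have sconj (M : structure L) (c : 'I_n -> M) (H : seq (formula L n)) :
    sat (conj H) c -> forall p, p \in H -> sat p c.
  elim: H => //= q H IH [hq /IH h] p; rewrite inE => /orP[/eqP ->|]//.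
  exact: h.
have bconj (H : seq (formula L n)) :
    (forall p, p \in H -> (b <= ev rz p a)%O) -> (b <= ev rz (conj H) a)%O.
  elim: H => [|q H IH] h; first by rewrite ev_valid ?lex1.
  rewrite [conj _]/= ev_and lexI h ?inE ?eqxx//= IH// => p pH.
  by apply: h; rewrite inE pH orbT.
have vG : valid (Not (conj G)).
  by move=> M c /= /sconj h; apply: nsat; exists M, c.
have := bconj _ bG; have := ev_valid rz vG a; rewrite ev_not => e.
by rewrite -[ev rz _ _]complK e compl1 lex0 (negbTE b0).
Qed.

(* For each truth assignment of positive probability to the events
   [[phi(a_i, b_j)]] the bipartite graph it describes would have no ladder,
   hence a small tree gap; so would their average, the matrix
   P[phi(a_i, b_j)]. *)
Lemma gap_order_property m n (phi : formula L (m + n)) (r e : R)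
    (a : nat -> 'I_m -> K) (b : nat -> 'I_n -> K) : 0 < e ->
    (forall i j, (i < j)%N -> mu (ev rz phi (tcat (a i) (b j))) <= r /\
       r + e <= mu (ev rz phi (tcat (a j) (b i)))) ->
  order_property T phi.
Proof.
move=> e0 gap; apply: order_property_compact => G k GT.
(* [e / 4] stays below the [e / 2] of [tree_gap_ge]; the length [k.+1] makes ['I_k.+1] inhabited,
   for [inord]. *)
have [|N N0 hN] := @ladder_free_tree_gap R k.+1 (e / 4); first by lra.
pose N' := (tree_size N).-1.
have NE : tree_size N = N'.+1 by rewrite prednK//; case: (N).
pose J := ('I_N'.+1 * 'I_N'.+1)%type.
pose E (x : J) : ev_alg rz := ev rz phi (tcat (a x.1) (b x.2)).
pose g (p : {ffun J -> bool}) i j := p (inord i, inord j).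
have mu0 := mu_ge0 (r := rz); have muD := mu_add (r := rz).
pose w (p : {ffun J -> bool}) := mu (atom E p).
have w1 : \sum_p w p = 1.
  rewrite -(mu_top rz) -(mu_atoms muD E).
  by apply: eq_bigr => p _; rewrite meet1x.
have [p [p0 lad]] : exists p, atom E p != \bot%O /\
    ladder (g p) k.+1 [set i | (i < tree_size N)%N] [set i | (i < tree_size N)%N].
  apply: contrapT => nlad.
  have small p : w p * tree_gap N 0 (fun i j => (g p i j)%:R) <= w p * (N%:R * (e / 4)).
    have [p0|p0] := eqVneq (atom E p) \bot%O.
      by rewrite /w p0 mu_bot// !mul0r.
    rewrite ler_wpM2l ?mu0// ltW// hN// => lad.
    by apply: nlad; exists p.
  have : tree_gap N 0 (fun i j => mu (ev rz phi (tcat (a i) (b j)))) <= N%:R * (e / 4).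
    rewrite (@eq_tree_gap _ _ _ _ (fun i j => \sum_p w p * (g p i j)%:R)); last first.
      move=> i j; rewrite add0n NE => hi hj.
      have := mu_meet_atoms mu0 muD E \top%O (inord i, inord j).
      rewrite meet1x /E /= !inordK// => <-.
      rewrite big_mkcond/=; apply: eq_bigr => p _; rewrite meet1x /g.
      by case: (p _); rewrite ?mulr1 ?mulr0.
    rewrite tree_gap_sum; apply: le_trans (ler_sum _ (fun p _ => small p)) _.
    by rewrite -mulr_suml w1 mul1r.
  have := tree_gap_ge N 0 gap; have : 0 < N%:R :> R by rewrite ltr0n.
  nra.
have [a' [b' [hab' ladE]]] := lad.
(* All coordinates of both sides of the half-graph form one finite tuple [c], so that a single call
   of [satisfiable] realizes them together. *)
pose V := ('I_k.+1 * 'I_m + 'I_k.+1 * 'I_n)%type.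
pose c (v : 'I_#|{: V}|) : K :=
  match enum_val v with inl x => a (a' x.1) x.2 | inr x => b (b' x.1) x.2 end.
pose sg s t : 'I_(m + n) -> 'I_#|{: V}| :=
  tcat (fun u => enum_rank (inl (s, u) : V)) (fun u => enum_rank (inr (t, u) : V)).
have csg s t : (fun v => c (sg s t v)) = tcat (a (a' s)) (b (b' t)).
  rewrite -[LHS]/(c \o sg s t) tcat_comp; congr tcat; apply/funext => u /=;
  by rewrite /c enum_rankK.
pose s0 (i : 'I_0) : 'I_#|{: V}| := match notF (ltn_ord i) with end.
pose lit (s t : 'I_k.+1) (q : formula L #|{: V}|) := if (s < t)%N then q else Not q.
(* The axioms in [G] and the diagram of the half-graph; all their brackets lie above the atom
   [p]. *)
pose G' := [seq frename p s0 | p <- G] ++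
  [seq lit st.1 st.2 (frename phi (sg st.1 st.2)) | st <- enum {: 'I_k.+1 * 'I_k.+1}].
have [q|M [d hd]] := @satisfiable _ G' c (atom E p) p0.
  rewrite mem_cat => /orP[/mapP[q' qG ->]|/mapP[[s t] _ ->]].
    by rewrite ev_rename ev_theory ?lex1//; exact: GT.
  rewrite /lit /=.
  have [_ hbt] := hab' t (ltn_ord t); have [has _] := hab' s (ltn_ord s).
  have := ladE s t (ltn_ord s) (ltn_ord t).
  have := atom_le E p (inord (a' s), inord (b' t)).
  rewrite /= NE in has hbt.
  rewrite /E /= !inordK// /g => + <-.
  by case: (p _); rewrite ?ev_not ev_rename csg.
exists M; exists (fun s u => d (enum_rank (inl (inord s, u) : V))).
exists (fun s u => d (enum_rank (inr (inord s, u) : V))); split.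
  move=> q qG x; have : sat (frename q s0) d.
    by apply: hd; rewrite mem_cat; apply/orP; left; apply/mapP; exists q.
  by move/sat_frename; rewrite (_ : (fun i => _) = x)//; apply/funext => -[].
move=> i j ik jk.
have dsg s t : (fun v => d (sg s t v)) = tcat (fun u => d (enum_rank (inl (s, u) : V)))
    (fun u => d (enum_rank (inr (t, u) : V))).
  by rewrite -[LHS]/(d \o sg s t) tcat_comp.
have : sat (lit (inord i) (inord j) (frename phi (sg (inord i) (inord j)))) d.
  apply: hd; rewrite mem_cat; apply/orP; right.
  by apply/mapP; exists (inord i, inord j) => //; rewrite mem_enum.
rewrite /lit (inordK (leqW ik)) (inordK (leqW jk)).
by case: (i < j)%N => /=; rewrite sat_frename dsg => h; split.
Qed.

End RandomizationBasics.

(** * Quantifier elimination *)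

Section UniformContinuity.
Local Open Scope classical_set_scope.
Local Open Scope ring_scope.
Variable R : realType.

Lemma ultra_fmap (X Y : Type) (f : X -> Y) (U : set_system X) :
  UltraFilter U -> UltraFilter (f @ U).
Proof.
move=> UU; split; first exact: fmap_proper_filter.
move=> G GP sub; apply/seteqP; split=> // A GA.
have [//|nA] := in_ultra_setVsetC (f @^-1` A) UU.
by have [x []] := filter_ex (filterI GA (sub (~` A) nA)).
Qed.

Lemma compact_cube (k : nat) : compact (@cube R k).
Proof.
rewrite (_ : @cube R k = [set v | forall i, `[0, 1]%classic (v ord0 i)]).
  by apply: (@rV_compact R k (fun=> `[0, 1]%classic)) => _; exact: segment_compact.
by apply/seteqP; split=> v /= h i; have := h i; rewrite /= in_itv.
Qed.

(** Heine-Cantor by ultrafilters: ever closer pairs violating the bound have first components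
    converging to a point [p] of the cube; continuity at [p] within the cube applies to both
    components. *)
Lemma connective_unif_cont (k : nat) (u : connective R k) (e : R) : 0 < e ->
  exists2 d : R, 0 < d & forall v w : 'rV[R]_k, cube v -> cube w ->
    (forall i, `|v ord0 i - w ord0 i| <= d) -> `|u v - u w| <= e.
Proof.
move=> e0; apply: contrapT => nd.
pose F : set_system ('rV[R]_k * 'rV[R]_k) := filter_from [set d : R | 0 < d]
  (fun d => [set x | [/\ cube x.1, cube x.2,
    (forall i, `|x.1 ord0 i - x.2 ord0 i| <= d) & e < `|u x.1 - u x.2|]]).
have FP : ProperFilter F.
  apply: filter_from_proper => [|d /= d0].
    apply: filter_from_filter; first by exists 1 => /=.
    move=> i j /= i0 j0; exists (Num.min i j); first by rewrite /= lt_min i0.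
    move=> x [c1 c2 h ?]; split; split=> // l; apply: le_trans (h l) _.
      by rewrite ge_min lexx.
    by rewrite ge_min lexx orbT.
  apply: contrapT => nx; apply: nd; exists d => // v w cv cw vw.
  by rewrite leNgt; apply/negP => h; apply: nx; exists (v, w).
have [U [UU FU]] := ultraFilterLemma FP.
have cu := compact_cube (k := k); rewrite compact_ultra in cu.
have [|p [cp Up]] := cu (fst @ U) (ultra_fmap fst UU).
  by apply: FU; exists 1 => //= x [].
have := u.(@conn_cont _ _); rewrite subspace_continuousP => /(_ p cp).
have e2 : 0 < e / 2 by lra.
move=> /cvgrPdist_lt /(_ _ e2); rewrite near_withinE.
move=> /nbhs_ballP[r /= r0 hr].
have r2 : 0 < r / 2 by lra.
have U1 : U [set x | ball p (r / 2) x.1].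
  by apply: Up; exact: nbhsx_ballx.
have r3 : 0 < r / 3 by lra.
have U2 := FU _ (ex_intro2 _ _ (r / 3) r3 (fun x h => h)).
have [x [/= [_ h1] []]] := filter_ex (filterI U1 U2).
move=> c1 c2 h2 h3.
have b1 : `|u p - u x.1| < e / 2.
  apply: hr => //; split=> // i j; apply: le_ball (h1 i j); lra.
have b2 : `|u p - u x.2| < e / 2.
  apply: hr => //; split=> // i j; rewrite (ord1 i).
  have := h1 ord0 j; have := h2 j; rewrite /ball/= => l1 l2.
  have := ler_normD (p ord0 j - x.1 ord0 j) (x.1 ord0 j - x.2 ord0 j).
  rewrite addrA subrK; lra.
have := ler_normD (u x.1 - u p) (u p - u x.2); rewrite addrA subrK.
by rewrite [`|u x.1 - u p|]distrC; lra.
Qed.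

End UniformContinuity.

(** * Ramsey's theorem for pairs *)

Section Ramsey.
Local Open Scope classical_set_scope.

Lemma extend_seq (S : set nat) (Q : nat -> nat -> Prop) :
    (forall l : seq nat, (forall y, y \in l -> S y) ->
       exists2 x, S x & forall y, y \in l -> Q y x) ->
  exists g : nat -> nat,
    (forall i, S (g i)) /\ forall i j, i < j -> Q (g i) (g j).
Proof.
move=> ext; have /choice[f hf] : forall l : seq nat, exists x,
    (forall y, y \in l -> S y) -> S x /\ forall y, y \in l -> Q y x.
  move=> l; have [/ext[x ? ?]|nl] := pselect (forall y, y \in l -> S y).
    by exists x.
  by exists 0 => /nl.
pose L n := iter n (fun l => f l :: l) [::].
have LS n : forall y, y \in L n -> S y.
  elim: n => //= n IH y; rewrite inE => /orP[/eqP ->|/IH//].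
  by have [] := hf _ IH.
have Lm i j : i < j -> f (L i) \in L j.
  elim: j => //= j IH; rewrite ltnS leq_eqVlt inE => /orP[/eqP ->|/IH ->].
    by rewrite eqxx.
  by rewrite orbT.
exists (fun n => f (L n)); split=> [i|i j ij]; first by have [] := hf _ (LS i).
by have [_] := hf _ (LS j); apply; exact: Lm.
Qed.

(** For a nonprincipal ultrafilter, each [i] has a colour [c i] shared by the pairs [(i, j)] for
    almost all [j], and [c] is almost everywhere some [c0]. Finitely many indices of colour [c0] can
    then always be extended by a further one. *)
Lemma ramsey_pairs (C : finType) (chi : nat -> nat -> C) :
  exists (g : nat -> nat) (c : C), forall i j, i < j ->
    g i < g j /\ chi (g i) (g j) = c.
Proof.
have [U [UU FU]] := ultraFilterLemma (_ : ProperFilter \oo).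
have pigeon (f : nat -> C) : exists c, U [set j | f j = c].
  apply: contrapT => nc.
  have : U [set j | forall c, f j <> c].
    apply: filter_forall => c.
    by have [h|//] := in_ultra_setVsetC [set j | f j = c] UU; case: nc; exists c.
  by move=> /filter_ex[j /(_ (f j))].
have /choice[c hc] := fun i => pigeon (chi i).
have [c0 hc0] := pigeon c.
have Ugt x : U [set j | x < j] by apply: FU; exists x.+1.
have [|g [gS gQ]] := @extend_seq [set i | c i = c0]
    (fun y x => y < x /\ chi y x = c0); last by exists g, c0.
elim=> [_|y l IH hl].
  by have [x hx] := filter_ex hc0; exists x.
have : U [set x | c x = c0 /\ forall y', y' \in y :: l -> y' < x /\ chi y' x = c0].
  elim: {IH} (y :: l) hl => [_|y' l' IH' hl'].
    by apply: filterS hc0 => x.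
  have U1 := IH' (fun z zl => hl' z (mem_behead (s := y' :: l') zl)).
  have U2 := hc y'; rewrite (hl' y' (mem_head _ _)) in U2.
  apply: filterS3 U1 U2 (Ugt y') => x [? h1] h2 h3; split=> // z.
  by rewrite inE => /orP[/eqP ->|/h1].
by move=> /filter_ex[x [? ?]]; exists x.
Qed.

End Ramsey.

Lemma tcons0 (X : Type) (n : nat) (x : X) (a : 'I_n -> X) : tcons x a ord0 = x.
Proof. by rewrite /tcons unlift_none. Qed.

Lemma tconsS (X : Type) (n : nat) (x : X) (a : 'I_n -> X) i :
  tcons x a (lift ord0 i) = a i.
Proof. by rewrite /tcons liftK. Qed.

(** * Gluing, back-and-forth and reduction to first order formulas *)

Section QuantifierElimination.
Local Open Scope classical_set_scope.
Local Open Scope ring_scope.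
Variables (R : realType) (L : language) (T : theory L).
Variables (K : cstructure (rand_sig R L)) (rz : randomization T K).
Let B := ev_alg rz.
Let mu_ge0' : forall b : B, 0 <= mu b := mu_ge0 (r := rz).
Let mu_add' : forall b c : B, (b `&` c)%O = \bot%O -> mu (b `|` c)%O = mu b + mu c :=
  mu_add (r := rz).

Definition ev_eq (x y : K) : B :=
  ev rz (Equal (Var L ord0) (Var L ord_max)) (fun i : 'I_2 => if i == ord0 then x else y).

Lemma ev_eqE n (i j : 'I_n) (a : 'I_n -> K) :
  ev rz (Equal (Var L i) (Var L j)) a = ev_eq (a i) (a j).
Proof.
pose s (k : 'I_2) := if k == ord0 then i else j.
have := ev_rename rz (Equal (Var L ord0) (Var L ord_max)) s a.
rewrite /= /s/= => ->; rewrite /ev_eq; congr (ev rz _ _).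
by apply/funext => k; case: ifP.
Qed.

Lemma mu_compl (b : B) : mu (~` b)%O = 1 - mu b.
Proof.
by rewrite -(mu_top rz) (mu_split mu_add' \top%O b) !meet1x; lra.
Qed.

Lemma ev_subst_eq n (p : formula L n.+1) (a : 'I_n -> K) (x z : K) :
  (ev rz p (tcons x a) `&` ev_eq z x <= ev rz p (tcons z a))%O.
Proof.
(* In the tuple (z, x, a), [s1] skips z and [s2] skips x. *)
pose s1 : 'I_n.+1 -> 'I_n.+2 := lift ord0.
pose s2 : 'I_n.+1 -> 'I_n.+2 := tcons ord0 (fun i => lift ord0 (lift ord0 i)).
have e1 (X : Type) (u v : X) (c : 'I_n -> X) :
    (fun i => tcons u (tcons v c) (s1 i)) = tcons v c.
  by apply/funext => i; rewrite /s1 tconsS.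
have e2 (X : Type) (u v : X) (c : 'I_n -> X) :
    (fun i => tcons u (tcons v c) (s2 i)) = tcons u c.
  by apply/funext => i; rewrite /s2; case: (unliftP ord0 i) => [j ->|->];
    rewrite ?tconsS !tcons0 || rewrite !tconsS.
have := @ev_le _ _ _ _ rz _ (And (frename p s1)
  (Equal (Var L ord0) (Var L (lift ord0 ord0)))) (frename p s2) (tcons z (tcons x a)).
rewrite ev_and !ev_rename e1 e2 ev_eqE tcons0 tconsS tcons0; apply.
move=> M c /= [/sat_frename h1 h2]; apply/sat_frename.
suff -> : (fun i => c (s2 i)) = (fun i => c (s1 i)) by [].
apply/funext => i; rewrite /s1 /s2 /tcons.
case: unliftP => [j ->|->]; first by [].
exact: h2.
Qed.

Lemma ev_ex_ge n (p : formula L n.+1) (a : 'I_n -> K) (x : K) :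
  (ev rz p (tcons x a) <= ev rz (Ex p) a)%O.
Proof.
have := @ev_le _ _ _ _ rz _ p (frename (Ex p) (lift ord0)) (tcons x a).
rewrite ev_rename (_ : (fun i => tcons x a (lift ord0 i)) = a); last first.
  by apply/funext => i; rewrite tconsS.
apply=> M c h; apply/sat_frename => /=; exists (c ord0).
rewrite (_ : tcons _ _ = c)//; apply/funext => i; rewrite /tcons.
by case: unliftP => [j ->|->].
Qed.

(* Random elements can be glued along an arbitrary event D: approximate D by
   some [[u = v]] and take a witness of
   exists z, (u = v -> z = x) /\ (u <> v -> z = y). *)
Lemma ev_glue (D : B) (x y : K) (e : R) : 0 < e -> exists z,
  mu (D `&` ~` ev_eq z x)%O < e /\ mu (~` D `&` ~` ev_eq z y)%O < e.
Proof.
move=> e0; have e2 : 0 < e / 2 by lra.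
have [uv huv] := ev_event D e2.
rewrite ev_eqE in huv; set u := uv ord0 in huv; set v := uv ord_max in huv.
pose S n : 'I_n -> 'I_n.+1 := lift ord0.
pose Vz : term L 5 := Var L ord0.
pose Vx : term L 5 := Var L (S _ ord0).
pose Vy : term L 5 := Var L (S _ (S _ ord0)).
pose Vu : term L 5 := Var L (S _ (S _ (S _ ord0))).
pose Vv : term L 5 := Var L (S _ (S _ (S _ (S _ ord0)))).
pose p := And (Not (And (Equal Vu Vv) (Not (Equal Vz Vx))))
              (Not (And (Not (Equal Vu Vv)) (Not (Equal Vz Vy)))).
have vp : valid (Ex p).
  move=> M c /=; rewrite /S.
  have [h|h] := pselect (c (S _ (S _ ord0)) = c (S _ (S _ (S _ ord0)))).
    by exists (c ord0); rewrite !tconsS !tcons0; split=> -[].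
  by exists (c (S _ ord0)); rewrite !tconsS !tcons0; split=> -[].
pose a : 'I_4 -> K := tcons x (tcons y (tcons u (fun=> v))).
have [z hz] := ev_full rz p a e2; exists z.
rewrite ev_valid// in hz.
have := mu_diff_symdiff mu_ge0' mu_add' \top%O (ev rz p (tcons z a)).
rewrite meet1x => /le_lt_trans /(_ hz).
rewrite /p ev_and !ev_not !ev_and !ev_not !ev_eqE /a /S !tconsS !tcons0.
rewrite !(complI, complU, complK) => hP.
(* Replacing [D] by [[[u = v]]] costs [e / 2] on either side, the approximate witness [z] the other
   half. *)
have h1 := le_lt_trans (mu_diff_symdiff mu_ge0' mu_add' _ _) huv.
have h2 : mu (ev_eq u v `&` ~` D)%O < e / 2.
  by move: huv; rewrite symdiffC; apply: le_lt_trans; exact: mu_diff_symdiff.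
set U := ev_eq u v in h1 h2 hP *.
split.
- apply: (@le_lt_trans _ _ (mu ((D `&` ~` U) `|` (U `&` ~` ev_eq z x))%O)).
    apply: mu_le => //; rewrite -[leLHS]meetx1 -(joinxC U) meetUr [leRHS]joinC.
    apply: leU2; first by rewrite [leLHS]meetC; apply: leI2 => //; exact: leIr.
    by apply: leI2 => //; exact: leIl.
  apply: le_lt_trans (mu_joinD mu_ge0' mu_add' _ _) _.
  suff : mu (U `&` ~` ev_eq z x)%O < e / 2 by lra.
  by apply: le_lt_trans hP; apply: mu_le => //; exact: leUl.
- apply: (@le_lt_trans _ _ (mu ((U `&` ~` D) `|` (~` U `&` ~` ev_eq z y))%O)).
    apply: mu_le => //; rewrite -[leLHS]meetx1 -(joinxC U) meetUr.
    apply: leU2; first by rewrite [leLHS]meetC; apply: leI2 => //; exact: leIl.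
    by rewrite [leLHS]meetC; apply: leI2 => //; exact: leIr.
  apply: le_lt_trans (mu_joinD mu_ge0' mu_add' _ _) _.
  suff : mu (~` U `&` ~` ev_eq z y)%O < e / 2 by lra.
  by apply: le_lt_trans hP; apply: mu_le => //; exact: leUr.
Qed.

(** By induction, glue a witness of [th q] on [D q] with the element found for the other indices off
    [D q]; disjointness leaves the other events intact. Each step halves the tolerance. *)
Lemma ev_glue_seq n (Q : eqType) (s : seq Q) (D : Q -> B)
    (th : Q -> formula L n.+1) (a : 'I_n -> K) (e : R) :
    uniq s -> (forall q q', q != q' -> (D q `&` D q')%O = \bot%O) ->
    (forall q, (D q <= ev rz (Ex (th q)) a)%O) -> 0 < e ->
  exists x, forall q, q \in s -> mu (D q `&` ~` ev rz (th q) (tcons x a))%O < e.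
Proof.
move=> + Ddisj Dth; elim: s e => [|q s IH] e /=.
  by move=> _ _; case: (ccarrier_inh K) => x; exists x.
move=> /andP[qs us] e0; have e2 : 0 < e / 2 by lra.
have [x hx] := IH _ us e2.
have [y hy] := ev_full rz (th q) a e2.
have [z [hz1 hz2]] := ev_glue (D q) y x e2.
exists z => q'; rewrite inE => /orP[/eqP -> |q's].
- apply: (@le_lt_trans _ _ (mu ((ev rz (Ex (th q)) a `&` ~` ev rz (th q) (tcons y a)) `|`
      (D q `&` ~` ev_eq z y))%O)).
    apply: mu_le => //.
    apply: le_trans (leI2 (lexx _) (_ : (_ <= ~` (ev rz (th q) (tcons y a) `&` ev_eq z y))%O)) _.
      by rewrite leC; exact: ev_subst_eq.
    by rewrite complI meetUr leU2// leI2.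
  apply: le_lt_trans (mu_joinD mu_ge0' mu_add' _ _) _.
  have := le_lt_trans (mu_diff_symdiff mu_ge0' mu_add' _ _) hy.
  by lra.
- have qq' : q != q' by apply: contraNneq qs => ->.
  apply: (@le_lt_trans _ _ (mu ((D q' `&` ~` ev rz (th q') (tcons x a)) `|`
      (~` D q `&` ~` ev_eq z x))%O)).
    apply: mu_le => //.
    apply: le_trans (leI2 (lexx _) (_ : (_ <= ~` (ev rz (th q') (tcons x a) `&` ev_eq z x))%O)) _.
      by rewrite leC; exact: ev_subst_eq.
    rewrite complI meetUr leU2// leI2// -disj_leC.
    by rewrite meetC Ddisj.
  apply: le_lt_trans (mu_joinD mu_ge0' mu_add' _ _) _.
  by have := hx _ q's; lra.
Qed.

Definition atom_formula n (J : finType) (psi : J -> formula L n)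
    (p : {ffun J -> bool}) : formula L n :=
  foldr (@And L n) (Ex (Equal (Var L ord0) (Var L ord0)))
    [seq if p j then psi j else Not (psi j) | j <- index_enum J].

Lemma ev_atom_formula n (J : finType) (psi : J -> formula L n) p (a : 'I_n -> K) :
  ev rz (atom_formula psi p) a = atom (fun j => ev rz (psi j) a) p.
Proof.
rewrite /atom_formula /atom; elim: (index_enum J) => [|j s IH] /=.
  rewrite big_nil ev_valid// => M c /=.
  by case: (carrier_inh M) => x; exists x.
by rewrite big_cons ev_and IH; case: (p j); rewrite ?ev_not.
Qed.

Definition close n (l : seq (formula L n)) (d : R) (a a' : 'I_n -> K) : Prop :=
  forall p, p \in l -> `|mu (ev rz p a) - mu (ev rz p a')| <= d.

Lemma close_sym n (l : seq (formula L n)) d a a' : close l d a a' -> close l d a' a.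
Proof. by move=> h p /h; rewrite distrC. Qed.

(** As soon as one term is positive, a full [d] has been subtracted. Thus pieces shortened by [d]
    each fit in an event that is smaller by [d], however many they are. *)
Lemma sum_max0_le (I : eqType) (s : seq I) (w : I -> R) (d : R) : 0 <= d ->
    (forall i, 0 <= w i) ->
  \sum_(i <- s) Num.max 0 (w i - d) <= Num.max 0 (\sum_(i <- s) w i - d).
Proof.
move=> d0 w0; elim: s => [|i s IH]; first by rewrite !big_nil le_max lexx.
rewrite !big_cons; apply: le_trans (lerD (lexx _) IH) _.
have wi := w0 i; have ws : 0 <= \sum_(i <- s) w i by apply: sumr_ge0.
have [h1|h1] := leP 0 (w i - d); have [h2|h2] := leP 0 (\sum_(i <- s) w i - d);
  rewrite le_max; apply/orP; (right; lra) || (left; lra).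
Qed.

(* Split each event [[chi_S(a')]], where chi_S says which of the atoms
   theta_p(x, y) are consistent, in pieces of measures close to those of
   [[chi_S(a)]] /\ [[theta_p(x, a)]]; then glue witnesses of the theta_p along
   these pieces.  Lower bounds suffice since atoms partition the unit event. *)
Lemma back_and_forth n (J : finType) (psi : J -> formula L n.+1) (e : R) : 0 < e ->
  exists (l : seq (formula L n)) (d : R), 0 < d /\
    forall a a', close l d a a' -> forall x, exists x', forall j,
      `|mu (ev rz (psi j) (tcons x a)) - mu (ev rz (psi j) (tcons x' a'))| <= e.
Proof.
move=> e0; pose P := {ffun J -> bool}; pose SP := {ffun P -> bool}.
pose th (p : P) := atom_formula psi p.
pose chi (A : SP) := atom_formula (fun p => Ex (th p)) A.
pose N : R := (#|{: SP}| * #|{: P}|).+1%:R.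
have N0 : 0 < N by rewrite ltr0n.
(* Each pair of a [chi A] and a [th p] causes an error [2 * d], and [N] exceeds the number of
   pairs. *)
pose d := e / (2 * N).
have d0 : 0 < d by rewrite divr_gt0// mulr_gt0.
exists [seq chi A | A <- enum {: SP}], d; split=> // a a' aa' x.
pose ex := atom (fun j => ev rz (psi j) (tcons x a)).
pose C A : B := ev rz (chi A) a; pose C' A : B := ev rz (chi A) a'.
have CC' A : mu (C A) <= mu (C' A) + d.
  have /aa' : chi A \in [seq chi A | A <- enum {: SP}] by rewrite map_f// mem_enum.
  by rewrite ler_distl => /andP[]; rewrite -/(C A) -/(C' A); lra.
pose w A p := mu (C A `&` ex p)%O.
have wC A : \sum_p w A p = mu (C A) by exact: mu_atoms.
have w0 A p : 0 <= w A p by exact: mu_ge0'.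
pose t A p := Num.max 0 (w A p - d).
have tC A : \sum_p t A p <= mu (C' A).
  apply: le_trans (sum_max0_le _ (ltW d0) (w0 A)) _.
  by rewrite wC ge_max mu_ge0'/=; have := CC' A; lra.
have /choice[c hc] : forall A, exists c : P -> B,
    (forall p, (c p <= C' A)%O /\ mu (c p) = t A p) /\
    (forall p q, p != q -> (c p `&` c q)%O = \bot%O).
  move=> A; have [|c [h1 h2]] := mu_pack mu_ge0' mu_add' (@mu_eq0 _ _ _ _ rz)
    (@mu_complete _ _ _ _ rz) (@mu_atomless _ _ _ _ rz) (index_enum_uniq P)
    (t := t A) _ (tC A).
    by move=> p; rewrite le_max lexx.
  by exists c; split=> [p|p q]; [apply: h1|apply: h2]; rewrite ?mem_index_enum.
pose D (q : SP * P) := c q.1 q.2.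
have [||x' hx'] := @ev_glue_seq n _ (enum {: SP * P}) D (fun q => th q.2) a' d
    (enum_uniq _) _ _ d0.
- move=> [A p] [A' p']; rewrite /D/=.
  have [->|SS'] := eqVneq A A'.
    by have [->|pp' _] := eqVneq p p'; [rewrite eqxx|have [_] := hc A'; apply].
  move=> _; have [/(_ p)[h1 _] _] := hc A; have [/(_ p')[h2 _] _] := hc A'.
  apply/eqP; rewrite -lex0; apply: le_trans (leI2 h1 h2) _.
  by rewrite /C' !ev_atom_formula atom_disjoint.
- move=> [A p]; rewrite /D/=; have [/(_ p)[h1 h2] _] := hc A.
  have := atom_le (fun p => ev rz (Ex (th p)) a') A p.
  case: ifP => Sp hS.
    by apply: le_trans h1 _; rewrite /C' ev_atom_formula.
  (* A [th p] ruled out by [A] gets no mass: [ex p] lies below [[[Ex (th p)]]], which is disjoint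
     from [C A]. *)
  suff -> : c A p = \bot%O by exact: le0x.
  apply: (@mu_eq0 _ _ _ _ rz); rewrite h2 /t.
  suff -> : w A p = 0 by apply/max_idPl; lra.
  rewrite /w (_ : (_ `&` _)%O = \bot%O) ?mu_bot//.
  apply/eqP; rewrite -lex0 /C ev_atom_formula.
  have := atom_le (fun p => ev rz (Ex (th p)) a) A p; rewrite Sp => h.
  rewrite -(meetCx (ev rz (Ex (th p)) a)); apply: leI2 => //.
  by rewrite /ex -ev_atom_formula; exact: ev_ex_ge.
pose ex' := atom (fun j => ev rz (psi j) (tcons x' a')).
(* For every [A], one [d] is lost in the truncation [t] and one in the gluing. *)
have low p : mu (ex p) - #|{: SP}|%:R * (2 * d) <= mu (ex' p).
  rewrite -(mu_atoms mu_add' (fun p => ev rz (Ex (th p)) a) (ex p)).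
  rewrite -(mu_atoms mu_add' (fun p => ev rz (Ex (th p)) a') (ex' p)).
  apply: (@le_trans _ _ (\sum_A (mu (ex p `&` atom (fun p => ev rz (Ex (th p)) a) A)%O
      - 2 * d))); first by rewrite sumrB sumr_const [_ * (2 * d)]mulr_natl.
  apply: ler_sum => A _.
  have [/(_ p)[h1 h2] _] := hc A.
  have := hx' (A, p); rewrite mem_enum => /(_ isT); rewrite /D/= ev_atom_formula => h3.
  have := mu_split mu_add' (c A p) (ex' p); rewrite h2 => h4.
  have h5 : mu (c A p `&` ex' p)%O <= mu (ex' p `&` C' A)%O.
    by apply: mu_le => //; rewrite meetC leI2.
  have h6 : w A p - d <= t A p by rewrite /t le_max lexx orbT.
  rewrite /C' ev_atom_formula in h5; rewrite /w /C ev_atom_formula meetC in h6.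
  by rewrite -/ex' in h3; lra.
exists x' => j.
have Ne : #|{: P}|%:R * (#|{: SP}|%:R * (2 * d)) <= e.
  rewrite mulrA -natrM mulnC /d (_ : 2 * _ = e / N); last by field; rewrite gt_eqF.
  rewrite mulrA ler_pdivrMr// mulrC ler_wpM2l ?(ltW e0)//.
  by rewrite ler_nat.
have c0 : 0 <= #|{: SP}|%:R * (2 * d) by apply: mulr_ge0 => //; apply: mulr_ge0 => //; exact: ltW.
set cst := #|{: SP}|%:R * (2 * d) in low Ne c0.
have lowb (F : pred P) : \sum_(p | F p) mu (ex p) - e <= \sum_(p | F p) mu (ex' p).
  apply: le_trans (ler_sum _ (fun p _ => low p)).
  rewrite sumrB lerD2l lerN2 sumr_const -mulr_natl.
  apply: le_trans Ne; rewrite ler_wpM2r// ler_nat.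
  exact: max_card.
have muE y (b : 'I_n -> K) : mu (ev rz (psi j) (tcons y b)) =
    \sum_(p : P | p j) mu (atom (fun j => ev rz (psi j) (tcons y b)) p).
  rewrite -[in LHS](meet1x (ev rz (psi j) _)).
  rewrite -(mu_meet_atoms mu_ge0' mu_add' (fun j => ev rz (psi j) (tcons y b)) \top%O).
  by apply: eq_bigr => p _; rewrite meet1x.
have muE' y (b : 'I_n -> K) : mu (ev rz (psi j) (tcons y b)) =
    1 - \sum_(p : P | ~~ p j) mu (atom (fun j => ev rz (psi j) (tcons y b)) p).
  rewrite muE -(mu_top rz) -(mu_atoms mu_add' (fun j => ev rz (psi j) (tcons y b)) \top%O).
  rewrite [X in _ = X - _](bigID (fun p : P => p j))/= -addrA.
  rewrite [X in _ = _ + X](_ : _ = 0) ?addr0.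
    by apply: eq_bigr => p _; rewrite meet1x.
  by apply/eqP; rewrite subr_eq0; apply/eqP/eq_bigr => p _; rewrite meet1x.
rewrite ler_distl; apply/andP; split.
- have := lowb (fun p => ~~ p j); have := muE' x a; have := muE' x' a'.
  by rewrite -/ex -/ex'; lra.
- have := lowb (fun p => p j); have := muE x a; have := muE x' a'.
  by rewrite -/ex -/ex'; lra.
Qed.

(** Ensures that [sup] and [inf] are taken of bounded sets and that connectives are evaluated in the
    cube. *)
Lemma ceval_range n (p : cformula (rand_sig R L) n) (a : 'I_n -> K) :
  0 <= ceval p a <= 1.
Proof.
elim: p a => {n} [n i j|n k P s|n k u ps IH|n p IH|n p IH] a /=.
- by rewrite mdist_ge0 ccarrier_diam.
- exact: pred_int_range.
- by apply: conn_range => i; rewrite mxE.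
- case: (ccarrier_inh K) => x.
  have ub : has_sup (range (fun x : K => ceval p (tcons x a))).
    split; first by exists (ceval p (tcons x a)), x.
    by exists 1 => _ [y _ <-]; have /andP[] := IH (tcons y a).
  apply/andP; split.
    apply: le_trans (sup_upper_bound ub _); last by exists x.
    by have /andP[] := IH (tcons x a).
  apply: ge_sup; first by case: ub.
  by move=> _ [y _ <-]; have /andP[] := IH (tcons y a).
- case: (ccarrier_inh K) => x.
  have lb : has_inf (range (fun x : K => ceval p (tcons x a))).
    split; first by exists (ceval p (tcons x a)), x.
    by exists 0 => _ [y _ <-]; have /andP[] := IH (tcons y a).
  apply/andP; split.
    apply: lb_le_inf; first by case: lb.
    by move=> _ [y _ <-]; have /andP[] := IH (tcons y a).
  apply: le_trans (ge_inf (proj2 lb) _) _; first by exists x.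
  by have /andP[] := IH (tcons x a).
Qed.

Lemma sup_range_le (f g : K -> R) (e : R) : (forall x, f x <= 1) ->
    (forall x, g x <= 1) -> (forall x, exists y, f x <= g y + e) ->
  sup (range f) <= sup (range g) + e.
Proof.
move=> f1 g1 fg; case: (ccarrier_inh K) => x0.
apply: ge_sup; first by exists (f x0), x0.
move=> _ [x _ <-]; have [y hy] := fg x; apply: le_trans hy _.
rewrite lerD2r; apply: sup_upper_bound; last by exists y.
by split; [exists (g x0), x0 | exists 1 => _ [z _ <-]].
Qed.

Lemma inf_range_le (f g : K -> R) (e : R) : (forall x, 0 <= f x) ->
    (forall x, 0 <= g x) -> (forall x, exists y, g y <= f x + e) ->
  inf (range g) <= inf (range f) + e.
Proof.
move=> f0 g0 fg; case: (ccarrier_inh K) => x0.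
rewrite -lerBlDr; apply: lb_le_inf; first by exists (f x0), x0.
move=> _ [x _ <-]; have [y hy] := fg x; rewrite lerBlDr.
apply: le_trans hy; apply: ge_inf; last by exists y.
by exists 0 => _ [z _ <-].
Qed.

(** Atomic formulas are values of [mu], up to an affine change for distances; connectives are
    uniformly continuous; for quantifiers, [back_and_forth] is used in both directions. *)
Lemma ceval_determined n (p : cformula (rand_sig R L) n) (e : R) : 0 < e ->
  exists (l : seq (formula L n)) (d : R), 0 < d /\
    forall a a' : 'I_n -> K, close l d a a' -> `|ceval p a - ceval p a'| <= e.
Proof.
have quant n' (q : cformula (rand_sig R L) n'.+1) (e' : R) :
    (forall e : R, 0 < e -> exists (l : seq (formula L n'.+1)) (d : R), 0 < d /\
       forall a a', close l d a a' -> `|ceval q a - ceval q a'| <= e) ->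
    0 < e' -> exists (l : seq (formula L n')) (d : R), 0 < d /\
    forall a a', close l d a a' -> forall x, exists x',
      `|ceval q (tcons x a) - ceval q (tcons x' a')| <= e'.
  move=> IH e0; have [l [d [d0 hl]]] := IH _ e0.
  have [l' [d' [d'0 hl']]] := back_and_forth (tnth (in_tuple l)) d0.
  exists l', d'; split=> // a a' aa' x; have [x' hx'] := hl' _ _ aa' x.
  exists x'; apply: hl => q'.
  by rewrite -[l]/(in_tuple l : seq _) => /tnthP[i ->]; exact: hx'.
elim: p e => {n} [n i j|n k P s|n k u ps IH|n p IH|n p IH] e e0.
- exists [:: Equal (Var L i) (Var L j)], e; split=> // a a' /(_ _ (mem_head _ _)) h /=.
  rewrite !(ev_dist rz); move: h; rewrite distrC.
  by congr (`|_| <= _); lra.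
- exists [:: frename (P : formula L k) s], e; split=> // a a' /(_ _ (mem_head _ _)) h /=.
  by rewrite !(ev_prob rz); move: h; rewrite !ev_rename.
- have [d d0 hd] := connective_unif_cont u e0.
  have /choice[l hl] := fun i => IH i _ d0.
  have /choice[d' hd'] := hl.
  (* The default 1 keeps the minimum positive when [k = 0]. *)
  exists (flatten [seq l i | i <- enum 'I_k]), (\big[Num.min/1]_i d' i); split.
    by elim/big_ind: _ => // [x y ? ?|i _]; [rewrite lt_min; apply/andP | have [] := hd' i].
  move=> a a' aa' /=; apply: hd => [i|i|i]; rewrite ?mxE ?ceval_range//.
  have [_] := hd' i; apply=> p pl; apply: le_trans (aa' p _) _.
    by apply/flatten_mapP; exists i; rewrite ?mem_enum.
  by rewrite (bigD1 i)//= ge_min lexx.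
- have [l [d [d0 hl]]] := quant _ _ _ IH e0.
  exists l, d; split=> // a a' aa' /=.
  have r1 (b : 'I_n -> K) (x : K) : ceval p (tcons x b) <= 1.
    by have /andP[] := ceval_range p (tcons x b).
  rewrite ler_distl lerBlDr; apply/andP; split; apply: sup_range_le => // x.
    have [x' h] := hl _ _ (close_sym aa') x.
    by exists x'; move: h; rewrite ler_distl => /andP[]; lra.
  have [x' h] := hl _ _ aa' x.
  by exists x'; move: h; rewrite ler_distl => /andP[]; lra.
- have [l [d [d0 hl]]] := quant _ _ _ IH e0.
  exists l, d; split=> // a a' aa' /=.
  have r0 (b : 'I_n -> K) (x : K) : 0 <= ceval p (tcons x b).
    by have /andP[] := ceval_range p (tcons x b).
  rewrite ler_distl lerBlDr; apply/andP; split; apply: inf_range_le => // x.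
    have [x' h] := hl _ _ aa' x.
    by exists x'; move: h; rewrite ler_distl => /andP[]; lra.
  have [x' h] := hl _ _ (close_sym aa') x.
  by exists x'; move: h; rewrite ler_distl => /andP[]; lra.
Qed.

(** On a homogeneous subsequence, either some formula of [l] has a gap between [i < j] and [j < i],
    in one direction or the other, or all its probabilities agree up to [d]; then the values of [p]
    would differ by at most [e / 2]. *)
Lemma gap_subformula m n (p : cformula (rand_sig R L) (m + n)) (r e : R)
    (a : nat -> 'I_m -> K) (b : nat -> 'I_n -> K) : 0 < e ->
    (forall i j, (i < j)%N -> ceval p (tcat (a i) (b j)) <= r /\
       r + e <= ceval p (tcat (a j) (b i))) ->
  exists psi : formula L (m + n), order_property T psi.
Proof.
move=> e0 gap; apply: contrapT => nop.
have [|l [d [d0 hl]]] := @ceval_determined _ p (e / 2); first by lra.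
pose f (k : 'I_(size l)) i j := mu (ev rz (tnth (in_tuple l) k) (tcat (a i) (b j))).
have f1 k i j : f k i j <= 1.
  by rewrite -(mu_top rz); apply: mu_le => //; exact: lex1.
pose M := (Num.truncn (2 / d)).+1.
have M0 : 0 < M%:R :> R by rewrite ltr0n.
have Md : 2 / M%:R <= d.
  by rewrite ler_pdivrMr// mulrC -ler_pdivrMr// ltW// truncnS_gt.
(* The colour of a pair records, for every formula of [l] and both orders of the indices, the cell
   of width [1 / M] containing the probability. *)
pose chi i j := [ffun x : 'I_(size l) * bool =>
  inord (Num.truncn (M%:R * (if x.2 then f x.1 i j else f x.1 j i))) : 'I_M.+1].
have [g [c hg]] := ramsey_pairs chi.
have hf k i j (s : bool) : (i < j)%N ->
    let y := if s then f k (g i) (g j) else f k (g j) (g i) in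
    (c (k, s))%:R <= M%:R * y < (c (k, s))%:R + 1.
  move=> ij; have [_ <-] := hg _ _ ij; rewrite /chi ffunE /=.
  set y := if s then _ else _.
  have y0 : 0 <= M%:R * y by rewrite mulr_ge0// /y; case: (s); exact: mu_ge0'.
  have y1 : M%:R * y <= M%:R by rewrite ler_piMr// /y; case: (s); exact: f1.
  rewrite inordK; first by rewrite natr1; exact: truncn_itv.
  by rewrite ltnS truncn_le_nat; apply: le_lt_trans y1 _; rewrite ltr_nat.
have M1 : 0 < 1 / M%:R :> R by rewrite divr_gt0.
have Mn k : k / M%:R * M%:R = k :> R by rewrite divfK// gt_eqF.
(* Cells at least two apart leave a gap of [1 / M]. *)
have cle k : (c (k, false) <= (c (k, true)).+1)%N.
  rewrite leqNgt; apply/negP => h; apply: nop; exists (tnth (in_tuple l) k).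
  apply: (@gap_order_property _ _ _ _ rz _ _ _ (((c (k, true)).+1)%:R / M%:R)
    (1 / M%:R) (a \o g) (b \o g) M1) => i j ij /=.
  have /andP[_ h1] := hf k _ _ true ij; have /andP[h2 _] := hf k _ _ false ij.
  have h3 : (c (k, true))%:R + 2 <= (c (k, false))%:R :> R.
    by rewrite -natrD ler_nat addn2.
  rewrite -/(f k (g i) (g j)) -/(f k (g j) (g i)) -mulrDl -natr1.
  split; first by rewrite ler_pdivlMr// mulrC; lra.
  by rewrite ler_pdivrMr// mulrC; lra.
(* A gap in the wrong direction is one in the right direction for the negation. *)
have cge k : (c (k, true) <= (c (k, false)).+1)%N.
  rewrite leqNgt; apply/negP => h; apply: nop; exists (Not (tnth (in_tuple l) k)).
  apply: (@gap_order_property _ _ _ _ rz _ _ _ (1 - (c (k, true))%:R / M%:R)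
    (1 / M%:R) (a \o g) (b \o g) M1) => i j ij /=.
  have /andP[h1 _] := hf k _ _ true ij; have /andP[_ h2] := hf k _ _ false ij.
  have h3 : (c (k, false))%:R + 2 <= (c (k, true))%:R :> R.
    by rewrite -natrD ler_nat addn2.
  rewrite !ev_not !mu_compl -/(f k (g i) (g j)) -/(f k (g j) (g i)).
  split; first by rewrite lerD2l lerN2 ler_pdivrMr// mulrC; lra.
  rewrite -addrA lerD2l -mulNr -mulrDl ler_pdivrMr// mulrC mulrN.
  by lra.
have : `|ceval p (tcat (a (g 0%N)) (b (g 1%N))) - ceval p (tcat (a (g 1%N)) (b (g 0%N)))| <= e / 2.
  apply: hl => psi; rewrite -[l]/(in_tuple l : seq _) => /tnthP[k ->].
  rewrite -/(f k (g 0%N) (g 1%N)) -/(f k (g 1%N) (g 0%N)).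
  apply: le_trans Md.
  have /andP[h1 h2] := hf k 0%N 1%N true isT.
  have /andP[h3 h4] := hf k 0%N 1%N false isT.
  have h5 : (c (k, true))%:R <= (c (k, false))%:R + 1 :> R by rewrite natr1 ler_nat.
  have h6 : (c (k, false))%:R <= (c (k, true))%:R + 1 :> R by rewrite natr1 ler_nat.
  rewrite ler_pdivlMr// -[X in _ * X]gtr0_norm// -normrM mulrC mulrBr.
  by rewrite ler_norml; apply/andP; split; lra.
have [h1 h2] := gap _ _ (proj1 (hg 0%N 1%N isT)).
by rewrite ler_norml => /andP[]; lra.
Qed.

End QuantifierElimination.

Theorem theorem5p14 (R : realType) (L : language) (T : theory L)
    (T_two : forall M : structure L, models T M -> exists x y : M, x <> y) :
  (forall (m n : nat) (phi : formula L (m + n)),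
     stable_formula T phi -> cstable_formula (@TR R L T) (Prob R phi)) /\
  (stable_theory T -> cstable_theory (@TR R L T)).
Proof.
split=> [m n phi|] st.
- move=> [K [[rz] [r [e [a [b [e0 gap]]]]]]]; apply: st.
  apply: (gap_order_property (rz := rz) e0 (a := a) (b := b) (r := r)) => i j.
  by move=> /gap; rewrite /= !(ev_prob rz).
- move=> m n p [K [[rz] [r [e [a [b [e0 gap]]]]]]].
  have [psi] := gap_subformula rz e0 gap.
  exact: st.
Qed.
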